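(* Let $d\in\mathbb{N}$, $0<\alpha<2$ and $\sigma>0$, and let $(\mu_t,t\ge0)$ be the rotationally invariant $\alpha$-stable convolution semigroup of probability measures on $\mathbb{R}^d$ determined by $$\widehat{\mu_t}(y)=\exp\{-t\sigma|y|^{\alpha}\},\qquad y\in\mathbb{R}^d,\ t\ge0.$$ For $t>0$ let $\widetilde{\mu_t}=\mu_t\circ\pi^{-1}$ be the pushforward of $\mu_t$ under the quotient map $\pi:\mathbb{R}^d\to\mathbb{T}^d=\mathbb{R}^d/\mathbb{Z}^d$. Then for every $t>0$ the measure $\widetilde{\mu_t}$ has a continuous density $F_t$ on $\mathbb{T}^d$, the operator $P_t$ on $L^2(\mathbb{T}^d)$ given by $$P_tH([x])=\int_{\mathbb{T}^d}H([x+y])F_t([y])\,d[y]$$ is trace-class, and $$F_t([0])=\mathrm{tr}(P_t).$$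
   Context: The Fourier transform of a finite Borel measure $\mu$ on $\mathbb{R}^d$ is $\widehat{\mu}(y)=\int_{\mathbb{R}^d}e^{-2\pi i x\cdot y}\mu(dx)$, and $|y|$ is the Euclidean norm. $[x]$ denotes the coset $x+\mathbb{Z}^d$. Densities and $L^2(\mathbb{T}^d)$ are taken with respect to Haar measure $d[y]$ on $\mathbb{T}^d$ of total mass $1$. *)

(* Defs.v *)
From HB Require Import structures.
From mathcomp Require Import all_boot all_order all_algebra.
From mathcomp Require Import complex ring.
From mathcomp Require Import all_classical all_reals all_analysis.

Set Implicit Arguments.
Unset Strict Implicit.
Unset Printing Implicit Defensive.
Import Order.TTheory GRing.Theory Num.Theory.
Import numFieldNormedType.Exports.
Local Open Scope classical_set_scope.
Local Open Scope ring_scope.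
Local Open Scope quotient_scope.
Local Open Scope complex_scope.

Section euclidean.
Variables (R : realType) (d : nat).
Implicit Types x y : 'rV[R]_d.

Definition borelRd := g_sigma_algebraType (@open 'rV[R]_d).

Definition dotp x y : R := \sum_(i < d) x ord0 i * y ord0 i.

(* The norm `|x| that the library puts on matrices is the sup norm. *)
Definition enorm x : R := Num.sqrt (dotp x x).

End euclidean.

Section complex_integral.
Context d (T : measurableType d) (R : realType).
Variable mu : {measure set T -> \bar R}.

Definition cintegral (f : T -> R[i]) : R[i] :=
  (\int[mu]_x complex.Re (f x)) +i* (\int[mu]_x complex.Im (f x)).

Definition cintegrable (f : T -> R[i]) : Prop :=
  mu.-integrable setT (fun x => (complex.Re (f x))%:E) /\
  mu.-integrable setT (fun x => (complex.Im (f x))%:E).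

Lemma cintegralD f g : cintegrable f -> cintegrable g ->
  cintegral (fun x => f x + g x) = cintegral f + cintegral g.
Proof.
move=> [fr fi] [gr gi]; rewrite /cintegral.
rewrite (@eq_Rintegral _ _ _ _ _ (fun x => complex.Re (f x) + complex.Re (g x))); last first.
  by move=> x _; case: (f x) (g x) => [? ?] [? ?].
rewrite [X in _ +i* X](@eq_Rintegral _ _ _ _ _ (fun x => complex.Im (f x) + complex.Im (g x))); last first.
  by move=> x _; case: (f x) (g x) => [? ?] [? ?].
by rewrite !RintegralD.
Qed.

Lemma cintegralZ a f : cintegrable f ->
  cintegral (fun x => a * f x) = a * cintegral f.
Proof.
case: a => a b [fr fi]; rewrite /cintegral.
have Zi c g : mu.-integrable setT (fun x => (g x)%:E) ->
    mu.-integrable setT (EFin \o (fun x => c * g x)).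
  by move=> ig; apply: (eq_integrable _ _ _ _ (integrableZl measurableT c ig)).
rewrite (@eq_Rintegral _ _ _ _ _ (fun x => a * complex.Re (f x) - b * complex.Im (f x))); last first.
  by move=> x _; case: (f x).
rewrite [X in _ +i* X](@eq_Rintegral _ _ _ _ _ (fun x => a * complex.Im (f x) + b * complex.Re (f x))); last first.
  by move=> x _; case: (f x).
rewrite RintegralB ?RintegralD ?RintegralZl//; exact: Zi.
Qed.

End complex_integral.

(* e^{i theta} *)
Definition cis (R : realType) (theta : R) : R[i] := cos theta +i* sin theta.

Definition fourier (R : realType) (d : nat)
    (mu : {measure set (borelRd R d) -> \bar R}) (y : 'rV[R]_d) : R[i] :=
  cintegral mu (fun x : borelRd R d => cis (- (2 * pi * dotp x y))).

Section torus.
Variables (R : realType) (d : nat).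

Definition lattice : {pred 'rV[R]_d} := mxOver Num.int.

Fact lattice_zmod_closed : zmod_closed lattice.
Proof.
split=> [|x y /mxOverP xZ /mxOverP yZ]; first exact: (mxOver0 (rpred0 _)).
by apply/mxOverP => i j; rewrite !mxE rpredB.
Qed.

HB.instance Definition _ :=
  GRing.isZmodClosed.Build 'rV[R]_d lattice lattice_zmod_closed.

Definition torus := Quotient.quot lattice.
HB.instance Definition _ := GRing.Zmodule.on torus.
HB.instance Definition _ := EqQuotient.on torus.
HB.instance Definition _ := isPointed.Build torus 0.

(* This is [quotient_topology torus], whose choiceType structure differs from *)
(* the one underlying the group structure of [torus].                         *)
Definition torus_open : set_system torus :=
  fun U => open (\pi_torus @^-1` U : set 'rV[R]_d).

Fact torus_openT : torus_open setT.
Proof. exact: openT. Qed.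

Fact torus_openI : setI_closed torus_open.
Proof. by move=> A B; exact: openI. Qed.

Fact torus_open_bigcup (I : Type) (f : I -> set torus) :
  (forall i, torus_open (f i)) -> torus_open (\bigcup_i f i).
Proof. by move=> fo; apply: bigcup_open => i _; exact: fo. Qed.

HB.instance Definition _ :=
  isOpenTopological.Build torus torus_openT torus_openI torus_open_bigcup.

HB.instance Definition _ :=
  Measurable.copy torus (g_sigma_algebraType (@open torus)).

(* The coset [x] = x + Z^d; in particular [0] is the zero of the group.       *)
Definition coset (x : borelRd R d) : torus := \pi_torus (x : 'rV[R]_d).

(* Normalised Haar measure is the unique such [lambda]; as the torus is       *)
(* compact and metrisable, every Borel probability on it is regular.          *)
Definition is_haar (lambda : probability torus R) : Prop :=
  forall (a : torus) (A : set torus), measurable A ->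
    lambda ((fun x => a + x) @^-1` A) = lambda A.

End torus.

Section L2.
Context d (T : measurableType d) (R : realType).
Variable mu : {measure set T -> \bar R}.

(* A complex function is square integrable iff its real and imaginary parts   *)
(* are.                                                                       *)
Definition sqintegrable : {pred T -> R[i]} := fun f =>
  ((fun x => complex.Re (f x)) \in Lfun mu 2%:E) &&
  ((fun x => complex.Im (f x)) \in Lfun mu 2%:E).

Fact sqintegrable_submod_closed : submod_closed sqintegrable.
Proof.
have [L0 LP] := Lfun_submod_closed mu (lee1n 2).
have LZ a f : f \in Lfun mu 2%:E -> a *: f \in Lfun mu 2%:E.
  by move=> fL; rewrite -[_ *: _]addr0; exact: (LP).
have LD f g : f \in Lfun mu 2%:E -> g \in Lfun mu 2%:E ->
    f + g \in Lfun mu 2%:E.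
  by move=> fL gL; rewrite -[f]scale1r; exact: (LP).
split=> [|[a b] f g /andP[fr fi] /andP[gr gi]]; first by apply/andP; split.
apply/andP; split.
- suff -> : (fun x => complex.Re (((a +i* b) *: f + g) x)) =
      a *: (fun x => complex.Re (f x)) +
      ((- b) *: (fun x => complex.Im (f x)) + (fun x => complex.Re (g x))).
    by apply: (LD); [exact: (LZ)|apply: (LD) => //; exact: (LZ)].
  apply/funext => x; rewrite !fctE.
  by case: (f x) (g x) => [? ?] [? ?]; rewrite /= addrA scaleNr.
- suff -> : (fun x => complex.Im (((a +i* b) *: f + g) x)) =
      a *: (fun x => complex.Im (f x)) +
      (b *: (fun x => complex.Re (f x)) + (fun x => complex.Im (g x))).
    by apply: (LD); [exact: (LZ)|apply: (LD) => //; exact: (LZ)].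
  apply/funext => x; rewrite !fctE.
  by case: (f x) (g x) => [? ?] [? ?]; rewrite /= addrA.
Qed.

HB.instance Definition _ := GRing.isSubmodClosed.Build R[i] (T -> R[i])
  sqintegrable sqintegrable_submod_closed.

Record sqfun := SqFun { sqfun_val :> T -> R[i]; _ : sqfun_val \in sqintegrable }.

HB.instance Definition _ := [isSub for sqfun_val].
HB.instance Definition _ := [Choice of sqfun by <:].
HB.instance Definition _ := [SubChoice_isSubLmodule of sqfun by <:].

Definition ae_null : {pred sqfun} := fun f => `[< {ae mu, forall x, f x = 0} >].

Fact ae_null_zmod_closed : zmod_closed ae_null.
Proof.
split=> [|f g /asboolP f0 /asboolP g0]; apply/asboolP.
  exact: aeW.
by apply: filterS2 f0 g0 => x fx gx; rewrite /= !fctE /= fx gx subr0.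
Qed.

HB.instance Definition _ :=
  GRing.isZmodClosed.Build sqfun ae_null ae_null_zmod_closed.

(* Complex L^2(mu): square integrable functions modulo equality almost        *)
(* everywhere.                                                                *)
Definition L2 := Quotient.quot ae_null.
HB.instance Definition _ := GRing.Zmodule.on L2.
HB.instance Definition _ := EqQuotient.on L2.

Lemma L2P (f g : sqfun) :
  f = g %[mod L2] <-> {ae mu, forall x, f x = g x}.
Proof.
split=> [/eqP|fg].
  rewrite -Quotient.idealrBE => /asboolP; apply: filterS => x.
  by rewrite /= !fctE => /eqP; rewrite subr_eq0 => /eqP.
apply/eqP; rewrite -Quotient.idealrBE; apply/asboolP; apply: filterS fg => x.
by rewrite /= !fctE => ->; rewrite subrr.
Qed.

Definition L2scale (a : R[i]) (f : L2) : L2 := \pi_L2 (a *: repr f).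

Lemma pi_L2scale a (f : sqfun) : L2scale a (\pi_L2 f) = \pi_L2 (a *: f).
Proof.
apply/L2P; have /L2P : repr (\pi_L2 f) = f %[mod L2] by rewrite reprK.
by apply: filterS => x; rewrite /= !fctE => ->.
Qed.

Fact L2scaleA a b f : L2scale a (L2scale b f) = L2scale (a * b) f.
Proof. by elim/quotW: f => f; rewrite (pi_L2scale b) !pi_L2scale scalerA. Qed.

Fact L2scale1 : left_id 1 L2scale.
Proof. by elim/quotW=> f; rewrite pi_L2scale scale1r. Qed.

Fact L2scaleDr : right_distributive L2scale +%R.
Proof.
move=> a; elim/quotW=> f; elim/quotW=> g.
by rewrite -raddfD !pi_L2scale scalerDr raddfD.
Qed.

Fact L2scaleDl f : {morph L2scale^~ f : a b / a + b}.
Proof. by elim/quotW: f => f a b; rewrite !pi_L2scale scalerDl raddfD. Qed.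

HB.instance Definition _ := GRing.Zmodule_isLmodule.Build R[i] L2
  L2scaleA L2scale1 L2scaleDr L2scaleDl.

(* An element of L^2 is applied to a point through a representative.          *)
Definition L2fun (f : L2) : T -> R[i] := repr f.
Coercion L2fun : L2 >-> Funclass.

Definition L2dot (f g : L2) : R[i] := cintegral mu (fun x => f x * (g x)^*).

Lemma sqfunP (f : sqfun) :
  (fun x => complex.Re (f x)) \in Lfun mu 2%:E /\
  (fun x => complex.Im (f x)) \in Lfun mu 2%:E.
Proof. by case: f => f /= /andP. Qed.

Lemma Lfun2_mul_integrable (f g : T -> R) :
  f \in Lfun mu 2%:E -> g \in Lfun mu 2%:E ->
  mu.-integrable setT (fun x => (f x * g x)%:E).
Proof. by move=> fL gL; exact/Lfun1_integrable/Lfun2_mul_Lfun1. Qed.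

Lemma cintegrable_mul_conj (f g : sqfun) :
  cintegrable mu (fun x => f x * (g x)^*).
Proof.
have [fr fi] := sqfunP f; have [gr gi] := sqfunP g.
split; apply: eq_integrable.
- exact: measurableT.
- 2: exact: (integrableD measurableT (Lfun2_mul_integrable fr gr)
                                     (Lfun2_mul_integrable fi gi)).
  by move=> x _; case: (f x) (g x) => [? ?] [? ?]; rewrite /= mulrN opprK EFinD.
- exact: measurableT.
- 2: exact: (integrableB measurableT (Lfun2_mul_integrable fi gr)
                                     (Lfun2_mul_integrable fr gi)).
  by move=> x _; case: (f x) (g x) => [? ?] [? ?] /=;
    rewrite -EFinB; congr EFin; ring.
Qed.

Lemma L2dot_pi (f g : sqfun) :
  L2dot (\pi_L2 f) (\pi_L2 g) = cintegral mu (fun x => f x * (g x)^*).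
Proof.
have reE (h : sqfun) : {ae mu, forall x, repr (\pi_L2 h) x = h x}.
  by apply/L2P; rewrite reprK.
have [ir ii] := cintegrable_mul_conj f g.
have [jr ji] := cintegrable_mul_conj (repr (\pi_L2 f)) (repr (\pi_L2 g)).
have fgE : {ae mu, forall x, repr (\pi_L2 f) x * (repr (\pi_L2 g) x)^* =
                             f x * (g x)^*}.
  by apply: filterS2 (reE f) (reE g) => x -> ->.
congr (_ +i* _); congr fine; apply: ae_eq_integral => //;
  try by [case/integrableP: jr|case/integrableP: ji
         |case/integrableP: ir|case/integrableP: ii].
- by apply: filterS fgE => x /= fx _; rewrite -fx.
- by apply: filterS fgE => x /= fx _; rewrite -fx.
Qed.

Fact L2dotDl (h : L2) : zmod_morphism (L2dot ^~ h).
Proof.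
elim/quotW: h => h; elim/quotW => f; elim/quotW => g /=.
rewrite -raddfB !L2dot_pi -mulN1r -cintegralZ; last exact: cintegrable_mul_conj.
rewrite -cintegralD; first last.
- suff -> : (fun x => -1 * (g x * (h x)^*)) = (fun x => (- g) x * (h x)^*).
    exact: cintegrable_mul_conj.
  by apply/funext => x; rewrite mulrA mulN1r.
- exact: cintegrable_mul_conj.
by congr cintegral; apply/funext => x; rewrite mulrA mulN1r -mulrDl.
Qed.

Fact L2dotZl (h : L2) : scalable_for *%R (L2dot ^~ h).
Proof.
elim/quotW: h => h a; elim/quotW => f /=.
rewrite [a *: _]pi_L2scale !L2dot_pi -cintegralZ; last exact: cintegrable_mul_conj.
by congr cintegral; apply/funext => x; rewrite mulrA.
Qed.

Fact L2dot_hermitian (f g : L2) : L2dot f g = (L2dot g f)^*.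
Proof.
elim/quotW: f => f; elim/quotW: g => g; rewrite !L2dot_pi /cintegral /=.
congr (_ +i* _); first by congr fine; apply: eq_integral => x _;
  case: (f x) (g x) => [? ?] [? ?] /=; congr EFin; ring.
have [_ gf] := cintegrable_mul_conj g f.
rewrite -mulN1r -RintegralZl//; apply: eq_Rintegral => x _.
by case: (f x) (g x) => [? ?] [? ?] /=; ring.
Qed.

Fact L2dotDr (h : L2) : zmod_morphism (L2dot h).
Proof.
move=> f g; rewrite (L2dot_hermitian h f) (L2dot_hermitian h g).
by rewrite L2dot_hermitian L2dotDl rmorphB.
Qed.

Fact L2dotZr (h : L2) : scalable_for (@conjc R \; *%R) (L2dot h).
Proof.
by move=> a f; rewrite L2dot_hermitian (L2dot_hermitian h f) L2dotZl rmorphM.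
Qed.

HB.instance Definition _ :=
  isBilinear.Build R[i] L2 L2 R[i] *%R (@conjc R \; *%R) L2dot
    L2dotDl L2dotDr L2dotZl L2dotZr.

Fact L2dot_hermitian_for (f g : L2) : L2dot f g = (-1) ^+ false * (L2dot g f)^*.
Proof. by rewrite mul1r L2dot_hermitian. Qed.

HB.instance Definition _ := isHermitianSesquilinear.Build R[i] L2 false
  (@conjc R) L2dot L2dot_hermitian_for.

Fact L2dot_gt0 (f : L2) : f != 0 -> 0 < L2dot f f.
Proof.
elim/quotW: f => f f0.
have [fr fi] := sqfunP f.
pose n2 x := complex.Re (f x) ^+ 2 + complex.Im (f x) ^+ 2.
have in2 : mu.-integrable setT (EFin \o n2).
  by apply: (eq_integrable _ _ _ _ (integrableD measurableT
    (Lfun2_mul_integrable fr fr) (Lfun2_mul_integrable fi fi))).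
have n20 x : 0 <= n2 x by rewrite addr_ge0 ?sqr_ge0.
rewrite L2dot_pi; suff -> : cintegral mu (fun x => f x * (f x)^*) =
    (\int[mu]_x n2 x)%:C.
  rewrite ltcR lt_def Rintegral_ge0// andbT; apply: contra f0 => /eqP n2i0.
  have [/(ae_eq_integral_abs mu measurableT)[n2ae _] _] := integrableP _ _ _ in2.
  have -> : (0 : L2) = \pi_L2 0 by rewrite raddf0.
  apply/eqP/L2P.
  apply: filterS (n2ae _) => [x /(_ I)[] /eqP|].
    rewrite paddr_eq0 ?sqr_ge0// !sqrf_eq0 => /andP[/eqP r0 /eqP i0].
    by case: (f x) r0 i0 => ? ? /= -> ->.
  under eq_integral do rewrite gee0_abs ?lee_fin//.
  by rewrite -[LHS]fineK ?integrable_fin_num// -/(Rintegral _ _ _) n2i0.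
congr (_ +i* _); first by apply: eq_Rintegral => x _;
  rewrite /n2; case: (f x) => ? ? /=; ring.
rewrite (@eq_Rintegral _ _ _ _ _ (cst 0)) ?Rintegral0//.
  by rewrite /Rintegral integral0.
by move=> x _; case: (f x) => ? ? /=; ring.
Qed.

HB.instance Definition _ := isDotProduct.Build R[i] L2 L2dot L2dot_gt0.

End L2.

(* Bounded operators on a complex, separable, infinite-dimensional Hilbert    *)
(* space [V], with inner product [dot], linear in its first argument.          *)
Section trace_class.
Variables (R : realType) (V : lmodType R[i]) (dot : {dot V for @conjc R}).
Implicit Types (P A : V -> V) (e : nat -> V).

Definition hnorm (v : V) : R := Num.sqrt (complex.Re (dot v v)).

Definition bounded_op A : Prop :=
  exists M : R, forall v, hnorm (A v) <= M * hnorm v.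

(* The order of R[i] makes this say that <A v, v> is real and nonnegative, so *)
(* that A is self-adjoint.                                                    *)
Definition positive_op A : Prop := forall v, 0 <= dot (A v) v.

(* A = |P|, the positive square root of P^* P. *)
Definition is_abs P A : Prop :=
  [/\ bounded_op A, positive_op A &
      forall u v, dot (A (A u)) v = dot (P u) (P v)].

(* In a Hilbert space, maximality is equivalent to having dense span.         *)
Definition hilbert_basis e : Prop :=
  (forall i j, dot (e i) (e j) = (i == j)%:R) /\
  (forall v, (forall n, dot v (e n) = 0) -> v = 0).

(* The sum of the <|P| e_n, e_n> does not depend on the orthonormal basis e.  *)
Definition trace_class (P : {linear V -> V}) : Prop :=
  bounded_op P /\
  exists A : {linear V -> V}, is_abs P A /\
  exists e, hilbert_basis e /\
    (\sum_(0 <= n <oo) (complex.Re (dot (A (e n)) (e n)))%:E < +oo)%E.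

(* Meant for a trace-class P. *)
Definition is_trace P (z : R[i]) : Prop :=
  forall e, hilbert_basis e ->
    (fun n => \sum_(k < n) dot (P (e k)) (e k) : R[i]^o) @ \oo --> (z : R[i]^o).

End trace_class.

(* P H ([x]) = \int H([x + y]) F([y]) d[y], for every representative H of an  *)
(* element of L^2.                                                            *)
Definition is_conv_op (R : realType) (d : nat) (lambda : probability (torus R d) R)
    (F : torus R d -> R) (P : L2 lambda -> L2 lambda) : Prop :=
  forall H : sqfun lambda,
    {ae lambda, forall x : torus R d, P (\pi_(L2 lambda) H) x =
      cintegral lambda (fun y : torus R d => H (x + y) * (F y)%:C)}.

(* Main.v *)
Require Import Defs.
From HB Require Import structures.
From mathcomp Require Import all_boot all_order all_algebra.
From mathcomp Require Import complex ring lra.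
From mathcomp Require Import all_classical all_reals all_analysis measurable_realfun.

Set Implicit Arguments.
Unset Strict Implicit.
Unset Printing Implicit Defensive.
Import Order.TTheory GRing.Theory Num.Theory.
Import numFieldNormedType.Exports.
Local Open Scope classical_set_scope.
Local Open Scope ring_scope.
Local Open Scope quotient_scope.
Local Open Scope complex_scope.

(** Write [chi n] for the character [x |-> exp(2 i pi n.x)] of the torus, [cosn n]
and [sinn n] for its real and imaginary parts, and put
[c n = exp(- t sigma |n|^alpha)] for [n] in Z^d.  By hypothesis [c n] is the
Fourier coefficient of index [n] of the image of [mu t] on the torus.  These
coefficients are even and summable ([lattice_expR_summable]), so the cosine series
with coefficients [c] converges uniformly to a continuous function [F] with the
same Fourier coefficients and with [F 0] equal to the sum of the [c n].  Fourier
coefficients determine a finite measure even against a signed density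
([fourier_coefficients_density]), hence [F] is the density of the image of [mu t].

Since [F] is even, the operator is [H |-> (x |-> \int H(z) F(z - x) dz)].  Expanding
[cosn n (z - x)] by the addition formula gives
[<P u, v> = sum_n c n (<u, cosn n> <cosn n, v> + <u, sinn n> <sinn n, v>)],
so [P] is self-adjoint and positive and is its own absolute value.  For any
Hilbert basis [e], Tonelli's theorem and Parseval's identity turn the sum of the
[<P e_j, e_j>] into the sum of the [c n (|cosn n|^2 + |sinn n|^2) = c n], which is
[F 0] ([diag_trace_eseries]).  The expansion in [cosn] and [sinn] makes every
coefficient real and nonnegative, so that no rearrangement of the series over Z^d
is needed.

Two facts of independent interest enter.  A Hilbert basis is by definition a maximal
orthonormal sequence, and Parseval's identity for it rests on the completeness of
L^2 ([riesz_fischer], [parseval]).  The characters are such a basis because a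
function whose Fourier coefficients vanish is null almost everywhere
([chi_hilbert_basis]), which is again the uniqueness theorem.  That theorem is
proved without convolution kernels: products of trigonometric polynomials are
trigonometric polynomials, so the sets whose indicator is a bounded pointwise limit
of such polynomials form a pi-system, and this pi-system generates the Borel sets
([torus_measurable_trig_limit]). *)

(** * Complex numbers through their real and imaginary parts *)

Section complex_parts.
Variable R : realType.
Implicit Types z w : R[i].

Lemma cReD z w : complex.Re (z + w) = complex.Re z + complex.Re w.
Proof. by case: z w => [? ?] [? ?]. Qed.
Lemma cImD z w : complex.Im (z + w) = complex.Im z + complex.Im w.
Proof. by case: z w => [? ?] [? ?]. Qed.
Lemma cReB z w : complex.Re (z - w) = complex.Re z - complex.Re w.
Proof. by case: z w => [? ?] [? ?]. Qed.
Lemma cImB z w : complex.Im (z - w) = complex.Im z - complex.Im w.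
Proof. by case: z w => [? ?] [? ?]. Qed.
Lemma cReJ z : complex.Re (conjc z) = complex.Re z.
Proof. by case: z. Qed.
Lemma cImJ z : complex.Im (conjc z) = - complex.Im z.
Proof. by case: z. Qed.
Lemma cReM z w : complex.Re (z * w) =
  complex.Re z * complex.Re w - complex.Im z * complex.Im w.
Proof. by case: z w => [? ?] [? ?]. Qed.
Lemma cImM z w : complex.Im (z * w) =
  complex.Re z * complex.Im w + complex.Im z * complex.Re w.
Proof. by case: z w => [? ?] [? ?]. Qed.
Lemma cRe_sum I (s : seq I) (f : I -> R[i]) :
  complex.Re (\sum_(i <- s) f i) = \sum_(i <- s) complex.Re (f i).
Proof. exact: (big_morph _ cReD). Qed.
Lemma complex_ext z w : complex.Re z = complex.Re w ->
  complex.Im z = complex.Im w -> z = w.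
Proof. by case: z w => [? ?] [? ?] /= -> ->. Qed.

Lemma conjcD z w : conjc (z + w) = conjc z + conjc w.
Proof. exact: rmorphD. Qed.
Lemma conjcB z w : conjc (z - w) = conjc z - conjc w.
Proof. exact: rmorphB. Qed.
Lemma conjcM z w : conjc (z * w) = conjc z * conjc w.
Proof. exact: rmorphM. Qed.

Definition csq z : R := complex.Re z ^+ 2 + complex.Im z ^+ 2.

Lemma csq_ge0 z : 0 <= csq z.
Proof. by rewrite addr_ge0 ?sqr_ge0. Qed.

Lemma mulcJ z : z * conjc z = (csq z)%:C.
Proof. by case: z => a b; apply: complex_ext; rewrite /csq /=; ring. Qed.

Lemma Re_mulJc z : complex.Re (conjc z * z) = csq z.
Proof. by rewrite mulrC mulcJ. Qed.

Lemma conjCE (z : R[i]) : Num.conj z = conjc z.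
Proof. by []. Qed.

End complex_parts.

Lemma cvgn_unique (R : realType) (u : nat -> R) (a b : R) :
  u @ \oo --> a -> u @ \oo --> b -> a = b.
Proof. by move=> /cvg_lim <- // /cvg_lim <-. Qed.

Lemma cvg_real_complex (R : realType) (u : nat -> R) (l : R) : u @ \oo --> l ->
  (fun n => (u n)%:C : R[i]^o) @ \oo --> (l%:C : R[i]^o).
Proof.
move=> /cvgrPdist_lt ul; apply/cvgrPdist_lt => -[x y].
rewrite ltcE /= => /andP[/eqP -> /ul]; apply: filterS => n.
have -> : (l%:C - (u n)%:C : R[i]^o) = (l - u n)%:C by rewrite rmorphB.
by rewrite normc_def /= expr0n /= addr0 sqrtr_sqr ltcR.
Qed.

(** * Hilbert bases and diagonal operators *)

Section hilbert.
Variables (R : realType) (V : lmodType R[i]) (dot : {dot V for @conjc R}).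
Implicit Types u v w : V.

Definition sqnorm v : R := complex.Re (dot v v).

Lemma dotC u v : dot u v = conjc (dot v u).
Proof. by rewrite hermC mul1r. Qed.
Lemma dotDl u v w : dot (u + v) w = dot u w + dot v w.
Proof. exact: linearDl. Qed.
Lemma dotBl u v w : dot (u - v) w = dot u w - dot v w.
Proof. exact: linearBl. Qed.
Lemma dotZl a u w : dot (a *: u) w = a * dot u w.
Proof. exact: linearZl_LR. Qed.
Lemma dotDr u v w : dot w (u + v) = dot w u + dot w v.
Proof. by rewrite dotC dotDl conjcD -!dotC. Qed.
Lemma dotBr u v w : dot w (u - v) = dot w u - dot w v.
Proof. by rewrite dotC dotBl conjcB -!dotC. Qed.
Lemma dotZr a u w : dot w (a *: u) = conjc a * dot w u.
Proof. by rewrite dotC dotZl conjcM -dotC. Qed.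
Lemma sqnormE v : dot v v = (sqnorm v)%:C.
Proof.
apply: complex_ext => //=; have := congr1 (@complex.Im R) (dotC v v).
rewrite cImJ; lra.
Qed.

Lemma sqnorm_gt0 v : v != 0 -> 0 < sqnorm v.
Proof. by move=> /(@neq0_dnorm_gt0 _ _ _ dot); rewrite sqnormE ltcR. Qed.

Lemma sqnorm0 : sqnorm 0 = 0.
Proof. by rewrite /sqnorm -[X in dot X _](subrr (0:V)) dotBl subrr. Qed.

Lemma sqnorm_ge0 v : 0 <= sqnorm v.
Proof.
by have [->|v0] := eqVneq v 0; [rewrite sqnorm0|exact/ltW/sqnorm_gt0].
Qed.

Lemma sqnormD u v : sqnorm (u + v) = sqnorm u + sqnorm v + 2 * complex.Re (dot u v).
Proof.
by rewrite /sqnorm dotDl !dotDr !cReD [dot v u]dotC cReJ; ring.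
Qed.

Lemma sqnormZ a u : sqnorm (a *: u) = csq a * sqnorm u.
Proof.
by rewrite /sqnorm dotZl dotZr mulrA mulcJ cReM /= mul0r subr0.
Qed.

Lemma sqnormN u : sqnorm (- u) = sqnorm u.
Proof.
by rewrite -scaleN1r sqnormZ /csq /= oppr0; ring.
Qed.

Lemma sqnormB u v : sqnorm (u - v) = sqnorm u + sqnorm v - 2 * complex.Re (dot u v).
Proof.
by rewrite /sqnorm dotBl !dotBr !cReB [dot v u]dotC cReJ; ring.
Qed.

Lemma cauchy_schwarz u v : csq (dot u v) <= sqnorm u * sqnorm v.
Proof.
have [->|v0] := eqVneq v 0.
  rewrite sqnorm0 mulr0 -(subrr 0) dotBr subrr /csq /=; lra.
have pv := sqnorm_gt0 v0.
have := sqnorm_ge0 ((sqnorm v)%:C *: u - dot u v *: v).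
rewrite sqnormB !sqnormZ dotZl dotZr mulrA -mulrA -/(dot u v).
rewrite [conjc _ * _]mulrC mulcJ.
have -> : complex.Re ((sqnorm v)%:C * (csq (dot u v))%:C) = sqnorm v * csq (dot u v).
  by rewrite cReM /=; ring.
have -> : csq (sqnorm v)%:C = sqnorm v ^+ 2 by rewrite /csq /=; ring.
by move=> h; rewrite -(ler_pM2l pv); lra.
Qed.

Lemma dot0l v : dot 0 v = 0.
Proof. exact: linear0l. Qed.

(** Completeness, with squared norms so that Pythagoras applies directly. *)
Definition complete_dot : Prop := forall s : nat -> V,
  (forall eps : R, 0 < eps -> exists N, forall m n, (N <= m)%N -> (m <= n)%N ->
     sqnorm (s n - s m) < eps) ->
  exists w, (fun n => sqnorm (s n - w)) @ \oo --> (0 : R).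

Section parseval.
Variable e : nat -> V.
Hypothesis e_basis : hilbert_basis dot e.
Variable v : V.

Let a k := dot v (e k).
Let s K := \sum_(k < K) a k *: e k.
Let S K := \sum_(k < K) csq (a k).

Let dot_s K n : dot (s K) (e n) = if (n < K)%N then a n else 0.
Proof.
elim: K => [|K IH]; first by rewrite /s big_ord0 dot0l.
rewrite /s big_ord_recr /= dotDl -/(s K) IH dotZl.
have [-> _] := e_basis; rewrite ltnS.
by case: ltngtP => [_|_|->] /=; rewrite ?mulr1 ?mulr0 ?add0r ?addr0.
Qed.

Let sqnorm_e n : sqnorm (e n) = 1.
Proof. by rewrite /sqnorm; have [-> _] := e_basis; rewrite eqxx. Qed.

Let sqnorm_rest K : sqnorm (v - s K) = sqnorm v - S K.
Proof.
elim: K => [|K IH]; first by rewrite /s /S !big_ord0 !subr0.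
rewrite /s /S !big_ord_recr /= opprD [v + (_ - _)]addrA -/(s K) -/(S K) sqnormB IH.
rewrite sqnormZ sqnorm_e dotZr dotBl dot_s ltnn subr0 -/(a K) Re_mulJc.
ring.
Qed.

Let sqnorm_inc m n : (m <= n)%N -> sqnorm (s n - s m) = S n - S m.
Proof.
move=> /subnKC <-; elim: (n - m)%N => [|p IH]; first by rewrite addn0 !subrr sqnorm0.
rewrite addnS /s /S !big_ord_recr /= -/(s _) -/(S _) addrAC sqnormD IH.
rewrite sqnormZ sqnorm_e dotZr dotBl !dot_s ltnn ltnNge leq_addr /= subrr mulr0 /=.
by rewrite -/(S m); ring.
Qed.

(** A maximal orthonormal sequence in a complete space is an orthonormal basis:
the partial Fourier sums converge by completeness, and the difference between
their limit and [v] is orthogonal to the sequence. *)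
Lemma parseval : complete_dot ->
  (fun K => \sum_(k < K) csq (dot v (e k))) @ \oo --> sqnorm v.
Proof.
move=> complete; rewrite -/S.
have ndS : {homo S : m n / (m <= n)%N >-> m <= n}.
  by move=> m n mn; rewrite -subr_ge0 -sqnorm_inc// sqnorm_ge0.
have cvS : cvgn S.
  apply: nondecreasing_is_cvgn => //; exists (sqnorm v) => _ [K _ <-].
  by rewrite -subr_ge0 -sqnorm_rest sqnorm_ge0.
have [w sw] : exists w, (fun n => sqnorm (s n - w)) @ \oo --> (0 : R).
  apply: complete => eps eps0.
  have /cvgrPdist_lt/(_ eps eps0)[N _ SN] := cvS.
  exists N => m n Nm mn; rewrite sqnorm_inc//.
  have := SN _ Nm; have := SN n (leq_trans Nm mn) => /=.
  have := nondecreasing_cvgn_le ndS cvS n; have := ndS _ _ mn.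
  by move: (limn S) => l h1 h2; rewrite ger0_norm; [|lra]; rewrite ger0_norm; lra.
suff vw : v = w.
  have -> : S = (fun K => sqnorm v - sqnorm (s K - w)).
    apply/funext => K; have -> : s K - w = - (v - s K) by rewrite opprB vw.
    by rewrite sqnormN sqnorm_rest; ring.
  by rewrite -[X in _ --> X]subr0; apply: cvgB => //; exact: cvg_cst.
apply/eqP; rewrite -subr_eq0; apply/eqP; have [_] := e_basis; apply => n.
have h K : (n < K)%N -> csq (dot (v - w) (e n)) <= sqnorm (s K - w).
  move=> nK; have -> : dot (v - w) (e n) = dot (s K - w) (e n).
    by rewrite !dotBl dot_s nK.
  by apply: le_trans (cauchy_schwarz _ _) _; rewrite sqnorm_e mulr1.
have : csq (dot (v - w) (e n)) <= 0.
  apply: (cvgr_to_ge sw).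
  by near=> K; apply: h; near: K; exists n.+1.
move=> c0; have {c0} : csq (dot (v - w) (e n)) == 0 by rewrite eq_le c0 csq_ge0.
rewrite paddr_eq0 ?sqr_ge0// !sqrf_eq0 => /andP[/eqP r0 /eqP i0].
exact: complex_ext.
Unshelve. all: by end_near. Qed.

End parseval.

Section diagonal_operator.
Variables (P : {linear V -> V}) (c : nat -> R) (S : R) (g h : nat -> V).
Hypothesis c_ge0 : forall k, 0 <= c k.
Hypothesis c_sum : (fun n => \sum_(k < n) c k) @ \oo --> S.
Hypothesis gh_unit : forall k, sqnorm (g k) + sqnorm (h k) = 1.

Let b k u v := dot u (g k) * conjc (dot v (g k)) + dot u (h k) * conjc (dot v (h k)).

Hypothesis P_Re : forall u v, (fun n => \sum_(k < n) c k * complex.Re (b k u v)) @ \oo -->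
  complex.Re (dot (P u) v).
Hypothesis P_Im : forall u v, (fun n => \sum_(k < n) c k * complex.Im (b k u v)) @ \oo -->
  complex.Im (dot (P u) v).

Let S_ge0 : 0 <= S.
Proof. by apply: (cvgr_to_ge c_sum); apply: nearW => n; exact: sumr_ge0. Qed.

Let bC k u v : b k v u = conjc (b k u v).
Proof. by apply: complex_ext; rewrite ?(cReJ, cImJ, cReD, cImD, cReM, cImM); ring. Qed.

Let bvv k v : b k v v = (csq (dot v (g k)) + csq (dot v (h k)))%:C.
Proof. by rewrite /b !mulcJ -rmorphD. Qed.

Lemma diag_selfadjoint u v : dot (P u) v = dot u (P v).
Proof.
rewrite [RHS]dotC; apply: complex_ext.
- rewrite cReJ; apply: (cvgn_unique (@P_Re u v)).
  by under eq_fun do under eq_bigr do rewrite -cReJ -bC; exact: P_Re.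
- rewrite cImJ; apply: (cvgn_unique (@P_Im u v)).
  under eq_fun do under eq_bigr do rewrite -[complex.Im _]opprK -cImJ -bC mulrN.
  by under eq_fun do rewrite sumrN; apply: cvgN; exact: P_Im.
Qed.

Lemma diag_Re v : (fun n => \sum_(k < n) c k * (csq (dot v (g k)) + csq (dot v (h k))))
  @ \oo --> complex.Re (dot (P v) v).
Proof.
by under eq_fun do under eq_bigr do rewrite -[_ + _]/(complex.Re _%:C) -bvv; exact: P_Re.
Qed.

Lemma diag_real v : dot (P v) v = (complex.Re (dot (P v) v))%:C.
Proof.
apply: complex_ext => //=; have := congr1 (@complex.Im R) (dotC (P v) v).
by rewrite cImJ -diag_selfadjoint; lra.
Qed.

Lemma diag_positive : positive_op dot P.
Proof.
move=> v; rewrite diag_real ler0c; apply: (cvgr_to_ge (@diag_Re v)).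
apply: nearW => n; apply: sumr_ge0 => k _; apply: mulr_ge0 => //.
by apply: addr_ge0; exact: csq_ge0.
Qed.

Let Re_b_le k u v : complex.Re (b k u v) <= (sqnorm u + sqnorm v) / 2.
Proof.
have hh x y : complex.Re (x * conjc y) <= (csq x + csq y) / 2 :> R.
  rewrite cReM cReJ cImJ /csq.
  have := sqr_ge0 (complex.Re x - complex.Re y).
  by have := sqr_ge0 (complex.Im x - complex.Im y); lra.
have kk w : csq (dot w (g k)) + csq (dot w (h k)) <= sqnorm w.
  rewrite -[leRHS]mulr1 -(gh_unit k) mulrDr.
  by apply: lerD; exact: cauchy_schwarz.
rewrite /b cReD; have := hh (dot u (g k)) (dot v (g k)).
have := hh (dot u (h k)) (dot v (h k)); have := kk u; have := kk v; lra.
Qed.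

Let Re_dot_le u v : complex.Re (dot (P u) v) <= S * ((sqnorm u + sqnorm v) / 2).
Proof.
apply: (ler_cvg_to (@P_Re u v) (cvgMr_tmp (b:=(sqnorm u + sqnorm v) / 2) c_sum)).
apply: nearW => n; rewrite mulr_suml; apply: ler_sum => k _.
by rewrite ler_wpM2l.
Qed.

(* The bound on [<P u, v>], tested at [S *: u] and [P u], bounds the norm of [P u]. *)
Let sqnorm_diag_le u : sqnorm (P u) <= S ^+ 2 * sqnorm u.
Proof.
have [S0|S0] := eqVneq S 0.
  have := Re_dot_le u (P u); rewrite S0 mul0r -/(sqnorm (P u)).
  by rewrite expr0n /= mul0r.
have {S0} S0 : 0 < S by rewrite lt0r S0.
have := Re_dot_le (S%:C *: u) (P u).
rewrite linearZ /= dotZl sqnormZ cReM /= mul0r subr0 -/(sqnorm (P u)).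
have -> : csq S%:C = S ^+ 2 by rewrite /csq /=; ring.
by rewrite ler_pM2l//; lra.
Qed.

Lemma diag_bounded : bounded_op dot P.
Proof.
exists S => v; rewrite /hnorm -[S]ger0_norm// -sqrtr_sqr -sqrtrM ?sqr_ge0//.
by rewrite ler_sqrt ?sqnorm_diag_le// mulr_ge0 ?sqr_ge0 ?sqnorm_ge0.
Qed.

Lemma diag_abs : is_abs dot P P.
Proof.
split; [exact: diag_bounded | exact: diag_positive | move=> u v].
exact: diag_selfadjoint.
Qed.

(** Tonelli: summing [<P e_j, e_j>] over a Hilbert basis [e] first in [j] gives, by
Parseval, weight [c k] times [|g k|^2 + |h k|^2 = 1]. *)
Lemma diag_trace_eseries (e : nat -> V) : complete_dot -> hilbert_basis dot e ->
  (\sum_(0 <= n <oo) (complex.Re (dot (P (e n)) (e n)))%:E = S%:E)%E.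
Proof.
move=> complete e_basis.
pose a j k := c k * (csq (dot (e j) (g k)) + csq (dot (e j) (h k))).
have a_ge0 j k : 0 <= a j k by apply: mulr_ge0 => //; apply: addr_ge0; exact: csq_ge0.
transitivity (\sum_(0 <= j <oo) \sum_(0 <= k <oo) (a j k)%:E)%E.
  apply: eq_eseriesr => j _; apply/esym/cvg_lim => //.
  under eq_fun do rewrite big_mkord sumEFin.
  by apply/cvg_EFin; [exact: nearW|exact: diag_Re].
rewrite nneseries_interchange//.
have csqC u v : csq (dot u v) = csq (dot v u).
  by rewrite dotC /csq cReJ cImJ sqrrN.
have parsevalC u : (fun K => \sum_(j < K) csq (dot (e j) u)) @ \oo --> sqnorm u.
  by under eq_fun do under eq_bigr do rewrite csqC; exact: parseval.
have row k : (\sum_(0 <= j <oo) (a j k)%:E = (c k)%:E)%E.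
  apply/cvg_lim => //.
  under eq_fun do rewrite big_mkord sumEFin -mulr_sumr big_split /=.
  apply/cvg_EFin; first exact: nearW.
  rewrite /comp /= -[X in _ --> X]mulr1 -(gh_unit k).
  by apply: cvgMl_tmp; apply: cvgD; exact: parsevalC.
rewrite (eq_eseriesr (fun k _ => row k)); apply/cvg_lim => //.
under eq_fun do rewrite big_mkord sumEFin.
by apply/cvg_EFin; [exact: nearW|exact: c_sum].
Qed.

Lemma diag_trace : complete_dot -> is_trace dot P S%:C.
Proof.
move=> complete e e_basis.
have t_ge0 n : 0 <= complex.Re (dot (P (e n)) (e n)).
  by have := diag_positive (e n); rewrite diag_real ler0c.
under eq_fun do under eq_bigr do rewrite diag_real.
under eq_fun do rewrite -rmorph_sum.
apply: cvg_real_complex.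
have := @is_cvg_nneseries _ _ xpredT 0%N
  (fun n _ _ => (t_ge0 n : (0 <= (complex.Re (dot (P (e n)) (e n)))%:E)%E)).
rewrite /= => /cvg_ex[l] /[dup] /cvg_lim lE.
rewrite -lE ?diag_trace_eseries// => /fine_cvg.
by under eq_fun do rewrite /= big_mkord sumEFin.
Qed.

Lemma diag_trace_class : complete_dot -> (exists e, hilbert_basis dot e) ->
  trace_class dot P.
Proof.
move=> complete [e e_basis]; split; first exact: diag_bounded.
exists P; split; first exact: diag_abs.
by exists e; split => //; rewrite diag_trace_eseries ?ltry.
Qed.

End diagonal_operator.
End hilbert.

(** * Summability over the integer lattice *)

Section lattice_sum.
Variable R : realType.

(** [exp x] dominates [x^(m+1) / (m+1)!]; with [m] such that [alpha (m + 1) >= 2] the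
terms are at most a multiple of [1 / k^2], whose sums telescope. *)
Lemma expRN_powR_sum_bound (s alpha : R) : 0 < s -> 0 < alpha ->
  exists C : R, forall N : nat, \sum_(k < N) expR (- (s * k%:R `^ alpha)) <= C.
Proof.
move=> s0 a0; pose w (k : nat) := expR (- (s * k%:R `^ alpha)).
have [m am] : exists m : nat, 2 <= alpha * m.+1%:R.
  exists (Num.truncn (2 / alpha)).
  by rewrite mulrC -ler_pdivrMr//; apply/ltW/truncnS_gt.
pose B : R := m.+1`!%:R / s ^+ m.+1.
have B0 : 0 < B by rewrite divr_gt0 ?exprn_gt0// ltr0n fact_gt0.
have w_le (k : nat) : w k.+1 <= B / k.+1%:R ^+ 2.
  have k1 : 1 <= k.+1%:R :> R by rewrite ler1n.
  have k0 : 0 < k.+1%:R :> R by rewrite ltr0n.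
  rewrite /w expRN -[leRHS]invrK lef_pV2 ?posrE ?expR_gt0//; last first.
    by rewrite invr_gt0 divr_gt0// exprn_gt0.
  have x0 : 0 <= s * k.+1%:R `^ alpha by rewrite mulr_ge0 ?powR_ge0// ltW.
  apply: le_trans (expR_ge1Dxn m x0); apply: ler_wpDl => //.
  have kk : k.+1%:R ^+ 2 <= (k.+1%:R `^ alpha) ^+ m.+1 :> R.
    rewrite -(powR_mulrn 2) ?(ltW k0)// -(powR_mulrn m.+1) ?powR_ge0//.
    by rewrite -powRrM ler_powR.
  have -> : (B / k.+1%:R ^+ 2)^-1 = s ^+ m.+1 / m.+1`!%:R * k.+1%:R ^+ 2.
    by rewrite /B !invfM !invrK [_^-1 * _]mulrC.
  rewrite exprMn [leRHS]mulrAC ler_pM2l//; apply: mulr_gt0; first exact: exprn_gt0.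
  by rewrite invr_gt0 ltr0n fact_gt0.
exists (1 + B * 2) => N.
have wN (M : nat) : \sum_(k < M.+2) w k <= 1 + B * (2 - M.+1%:R^-1).
  elim: M => [|M IH].
    rewrite big_ord_recl big_ord1 /= /bump /= addn0; apply: lerD.
      by rewrite -[leRHS]expR0 ler_expR oppr_le0 mulr_ge0 ?powR_ge0// ltW.
    by apply: le_trans (w_le 0%N) _; rewrite expr1n invr1; lra.
  rewrite big_ord_recr /=; apply: le_trans (lerD IH (w_le M.+1)) _.
  rewrite -addrA lerD2l -mulrDr ler_pM2l//.
  have h1 : M.+1%:R^-1 - M.+2%:R^-1 = (M.+1%:R * M.+2%:R)^-1 :> R.
    have := ler0n R M; rewrite -!natr1; move: (M%:R) => x x0.
    by field; apply/andP; split; apply: lt0r_neq0; lra.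
  suff : (M.+2%:R ^+ 2)^-1 <= (M.+1%:R * M.+2%:R)^-1 :> R.
    rewrite -h1; move: (M.+1%:R^-1) (M.+2%:R^-1) (_ ^-1) => x y z; lra.
  by rewrite lef_pV2 ?posrE ?exprn_gt0 ?mulr_gt0 ?ltr0n// ler_pM2r ?ltr0n// ler_nat.
apply: (@le_trans _ _ (\sum_(k < N.+2) w k)).
  by rewrite !big_ord_recr /= -addrA lerDl addr_ge0 ?expR_ge0.
by apply: le_trans (wN N) _; rewrite lerD2l ler_pM2l// gerBl invr_ge0.
Qed.

Variable d : nat.

Lemma lattice_enum : (0 < d)%N -> exists nu : nat -> 'rV[int]_d, bijective nu.
Proof.
move=> d0.
have : ([set: 'rV[int]_d] #= [set: nat])%card.
  rewrite card_eq_le [X in X && _]countableP /=.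
  have <- : (fun v : 'rV[int]_d => absz (v ord0 (Ordinal d0))) @` setT = setT.
    by apply/seteqP; split => // n _; exists (const_mx n%:Z) => //; rewrite mxE.
  exact: card_image_le.
move=> /card_set_bijP[nu]; rewrite setTT_bijective => -[mu numu munu].
by exists mu, nu.
Qed.

Lemma powR_enorm_ge (alpha : R) (x : 'rV[R]_d) (i : 'I_d) : 0 < alpha ->
  `|x ord0 i| `^ alpha <= enorm x `^ alpha.
Proof.
move=> a0; apply: ge0_ler_powR; rewrite ?nnegrE ?sqrtr_ge0 ?(ltW a0)//.
rewrite -sqrtr_sqr ler_sqrt; last by apply: sumr_ge0 => j _; rewrite -expr2 sqr_ge0.
rewrite /dotp (bigD1 i)//= -expr2 lerDl.
by apply: sumr_ge0 => j _; rewrite -expr2 sqr_ge0.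
Qed.

(** The summand is dominated by a product of one-dimensional terms, and the sum
of these over a box is a power of a one-dimensional sum. *)
Lemma lattice_expR_summable (s alpha : R) (nu : nat -> 'rV[int]_d) :
  0 < s -> 0 < alpha -> injective nu ->
  cvgn (fun n => \sum_(k < n) expR (- (s * enorm (map_mx intr (nu k)) `^ alpha))).
Proof.
move=> s0 a0 nu_inj.
have [d0|d0] := posnP d.
  exfalso; suff : nu 0%N = nu 1%N by move=> /nu_inj.
  by apply/rowP => i; have := ltn_ord i; rewrite {2}d0.
have dR : 0 < d%:R :> R by rewrite ltr0n.
have [C CN] := expRN_powR_sum_bound (divr_gt0 s0 dR) a0.
pose w (z : int) := expR (- (s / d%:R * (absz z)%:R `^ alpha)).
apply: nondecreasing_is_cvgn.
  by apply/nondecreasing_seqP => n; rewrite big_ord_recr /= lerDl expR_ge0.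
exists ((2 * C) ^+ d) => _ [n _ <-].
have term k : expR (- (s * enorm (map_mx intr (nu k)) `^ alpha)) <=
    \prod_(i < d) w (nu k ord0 i).
  rewrite -expR_sum ler_expR sumrN lerN2 -mulr_sumr.
  rewrite -ler_pdivlMl ?divr_gt0// invf_div mulrA divfK ?gt_eqF//.
  apply: (@le_trans _ _ (\sum_(i < d) enorm (map_mx intr (nu k)) `^ alpha)).
    apply: ler_sum => i _; apply: le_trans (powR_enorm_ge _ i a0).
    by rewrite mxE natr_absz intr_norm.
  by rewrite sumr_const card_ord mulr_natl.
apply: (@le_trans _ _ (\sum_(k < n) \prod_(i < d) w (nu k ord0 i))).
  by apply: ler_sum => k _; exact: term.
(* An integer of absolute value below [N] is coded by a sign and a natural number; zero
   has two codes, which can only enlarge the sum. *)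
pose N := (\max_(k < n) \max_(i < d) absz (nu k ord0 i)).+1.
pose val (p : bool * 'I_N) : int := (-1) ^+ p.1 * (p.2 : nat)%:Z.
pose code (z : int) : bool * 'I_N := (z < 0, inord (absz z)).
have codeK (k : 'I_n) i : val (code (nu k ord0 i)) = nu k ord0 i.
  rewrite /val /code /= inordK -?intEsign// ltnS.
  apply: leq_trans (leq_bigmax k) => /=.
  exact: (leq_bigmax (F := fun i => absz (nu k ord0 i))).
pose cd (k : 'I_n) : {ffun 'I_d -> bool * 'I_N} := [ffun i => code (nu k ord0 i)].
have cd_inj : injective cd.
  move=> j k /ffunP jk; apply/val_inj/nu_inj/rowP => i.
  by have := jk i; rewrite !ffunE => /(congr1 val); rewrite !codeK.
apply: (@le_trans _ _ (\sum_(f : {ffun 'I_d -> bool * 'I_N}) \prod_(i < d) w (val (f i)))).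
  rewrite (eq_bigr (fun k => \prod_(i < d) w (val (cd k i)))); last first.
    by move=> k _; apply: eq_bigr => i _; rewrite ffunE codeK.
  pose G (f : {ffun 'I_d -> bool * 'I_N}) := \prod_(i < d) w (val (f i)).
  have -> : \sum_(k < n) \prod_(i < d) w (val (cd k i)) =
      \sum_(f in [seq cd k | k : 'I_n]) G f.
    rewrite -[RHS]big_uniq ?big_image //=; last first.
      by rewrite map_inj_uniq ?enum_uniq.
  rewrite [leLHS]big_mkcond /=; apply: ler_sum => f _.
  by case: ifP => // _; apply: prodr_ge0 => i _; exact: expR_ge0.
rewrite -(bigA_distr_bigA (fun (i : 'I_d) p => w (val p))) /=.
rewrite prodr_const card_ord; apply: lerXn2r; rewrite ?nnegrE.
- by apply: sumr_ge0 => p _; exact: expR_ge0.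
- rewrite mulr_ge0//; apply: le_trans (CN 0%N); by rewrite big_ord0.
rewrite -(pair_bigA _ (fun b j => w (val (b, j)))) /= big_bool /= mulr_natl mulr2n.
have wE b : \sum_(j < N) w (val (b, j)) <= C.
  apply: le_trans (CN N); rewrite le_eqVlt; apply/orP; left; apply/eqP.
  by apply: eq_bigr => j _; rewrite /w /val abszMsign.
exact: lerD.
Qed.

End lattice_sum.

(** * The torus and its characters *)

Section cis_theory.
Variable R : realType.
Implicit Types a b : R.

Lemma cisD a b : cis (a + b) = cis a * cis b.
Proof. by apply: complex_ext; rewrite ?(cReM, cImM) /= ?cosD ?sinD // addrC. Qed.

Lemma cisN a : cis (- a) = conjc (cis a).
Proof. by rewrite /cis cosN sinN. Qed.

Lemma cis0 : cis (0 : R) = 1.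
Proof. by rewrite /cis cos0 sin0. Qed.

Lemma cis_nat n : cis (2 * pi * n%:R : R) = 1.
Proof.
rewrite /cis; have -> : 2 * pi * n%:R = 0 + (pi *+ 2) *+ n :> R.
  by rewrite add0r -(mulr_natl pi) mulr_natr.
by rewrite (periodicn (@cosD2pi R)) (periodicn (@sinD2pi R)) cos0 sin0.
Qed.

Lemma cis_int a : a \is a Num.int -> cis (2 * pi * a) = 1.
Proof.
move=> /intrP[[n|n] ->]; first exact: cis_nat.
by rewrite NegzE mulrNz mulrN cisN cis_nat conjc1.
Qed.

End cis_theory.

Section torus_theory.
Variables (R : realType) (d : nat).
Local Notation T := (torus R d).
Local Notation rV := 'rV[R]_d.
Implicit Types (x y z : T) (u v : rV) (n : 'rV[int]_d).

Lemma torus_piD u v : \pi_T (u + v) = \pi_T u + \pi_T v :> T.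
Proof. exact: raddfD. Qed.

Lemma torus_piN u : \pi_T (- u) = - (\pi_T u) :> T.
Proof. exact: raddfN. Qed.

Lemma torus_pi_lattice u : (forall i, u ord0 i \is a Num.int) -> \pi_T u = 0 :> T.
Proof.
move=> uZ; rewrite -(raddf0 (\pi_T)); apply/eqP.
by rewrite -Quotient.idealrBE subr0; apply/mxOverP => i j; rewrite ord1.
Qed.

Lemma repr_pi_int u i : (repr (\pi_T u : T) - u) ord0 i \is a Num.int.
Proof.
have : repr (\pi_T u : T) - u \in @lattice R d.
  by rewrite Quotient.idealrBE reprK.
by move=> /mxOverP.
Qed.

Lemma dotpDr u v w : dotp u (v + w) = dotp u v + dotp u w :> R.
Proof. by rewrite /dotp -big_split; apply: eq_bigr => i _; rewrite mxE mulrDr. Qed.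

Lemma dotpDl u v w : dotp (u + v) w = dotp u w + dotp v w :> R.
Proof. by rewrite /dotp -big_split; apply: eq_bigr => i _; rewrite mxE mulrDl. Qed.

Lemma dotpNl u v : dotp (- u) v = - dotp u v :> R.
Proof. by rewrite /dotp -sumrN; apply: eq_bigr => i _; rewrite mxE mulNr. Qed.

Lemma dotpC u v : dotp u v = dotp v u :> R.
Proof. by apply: eq_bigr => i _; rewrite mulrC. Qed.

Definition intvec n : rV := map_mx intr n.

Lemma intvecD m n : intvec (m + n) = intvec m + intvec n.
Proof. by apply/rowP => i; rewrite !mxE intrD. Qed.
Lemma intvecN n : intvec (- n) = - intvec n.
Proof. by apply/rowP => i; rewrite !mxE intrN. Qed.

(** Computed on a representative; [chi], [cosn] and [sinn] do not depend on it. *)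
Definition phase n x : R := 2 * pi * dotp (intvec n) (repr x).
Definition chi n x : R[i] := cis (phase n x).

Lemma chi_pi n u : chi n (\pi_T u) = cis (2 * pi * dotp (intvec n) u).
Proof.
rewrite /chi /phase -[X in repr X](subrK 0); set r := repr _.
have -> : dotp (intvec n) r = dotp (intvec n) (r - u) + dotp (intvec n) u.
  by rewrite -dotpDr subrK.
rewrite mulrDr cisD cis_int ?mul1r//; apply: rpred_sum => i _.
by apply: rpredM; [rewrite mxE intr_int|rewrite /r subrK; exact: repr_pi_int].
Qed.

Lemma chiDr n x y : chi n (x + y) = chi n x * chi n y.
Proof.
rewrite -(reprK x) -(reprK y) -torus_piD !chi_pi -cisD -mulrDr.
by rewrite dotpDr.
Qed.

Lemma chiNr n x : chi n (- x) = conjc (chi n x).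
Proof.
rewrite -(reprK x) -torus_piN !chi_pi -cisN -mulrN.
by rewrite dotpC dotpNl dotpC.
Qed.

Lemma chiDl m n x : chi (m + n) x = chi m x * chi n x.
Proof. by rewrite /chi /phase -cisD -mulrDr intvecD dotpDl. Qed.

Lemma chiNl n x : chi (- n) x = conjc (chi n x).
Proof. by rewrite /chi /phase -cisN -mulrN intvecN dotpNl. Qed.

Lemma chi0l x : chi 0 x = 1.
Proof.
rewrite /chi /phase (_ : dotp _ _ = 0) ?mulr0 ?cis0//.
by apply: big1 => i _; rewrite !mxE mul0r.
Qed.

Lemma chi0r n : chi n 0 = 1.
Proof.
rewrite -(raddf0 (\pi_T)) chi_pi (_ : dotp _ _ = 0) ?mulr0 ?cis0//.
by apply: big1 => i _; rewrite !mxE mulr0.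
Qed.

Definition cosn n x : R := cos (phase n x).
Definition sinn n x : R := sin (phase n x).

Lemma chiE n x : chi n x = cosn n x +i* sinn n x.
Proof. by []. Qed.

Lemma cosn_sub n x y : cosn n (x - y) = cosn n x * cosn n y + sinn n x * sinn n y.
Proof.
have := congr1 (@complex.Re R) (chiDr n x (- y)).
by rewrite chiNr cReM /= mulrN opprK.
Qed.

Lemma cosn_pi n u : cosn n (\pi_T u) = cos (2 * pi * dotp (intvec n) u).
Proof. by have [] := chi_pi n u. Qed.
Lemma sinn_pi n u : sinn n (\pi_T u) = sin (2 * pi * dotp (intvec n) u).
Proof. by have [] := chi_pi n u. Qed.

Lemma torus_openE (U : set T) : open U = open (\pi_T @^-1` U : set rV).
Proof. by []. Qed.

Lemma torus_continuous (K : topologicalType) (f : T -> K) :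
  continuous (fun u : rV => f (\pi_T u)) -> continuous f.
Proof.
by move=> /continuousP fc; apply/continuousP => U /fc; rewrite torus_openE.
Qed.

Lemma continuous_torus_pi : continuous (\pi_T : rV -> T).
Proof. by apply/continuousP => U; rewrite torus_openE. Qed.

Lemma continuous_dotp u : continuous (dotp u : rV -> R).
Proof.
apply: continuous_big => [|i _]; first exact: add_continuous.
by move=> v; apply: continuousM; [exact: cst_continuous|exact: coord_continuous].
Qed.

Lemma continuous_cosn n : continuous (cosn n).
Proof.
apply: torus_continuous; under eq_fun do rewrite cosn_pi.
move=> u; apply: (@continuous_comp _ _ _ (fun u => 2 * pi * dotp (intvec n) u) (@cos R)).
  by apply: continuousM; [exact: cst_continuous|exact: continuous_dotp].
exact: continuous_cos.
Qed.

Lemma continuous_sinn n : continuous (sinn n).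
Proof.
apply: torus_continuous; under eq_fun do rewrite sinn_pi.
move=> u; apply: (@continuous_comp _ _ _ (fun u => 2 * pi * dotp (intvec n) u) (@sin R)).
  by apply: continuousM; [exact: cst_continuous|exact: continuous_dotp].
exact: continuous_sin.
Qed.

Lemma torus_continuous_measurable (f : T -> R) : continuous f -> measurable_fun setT f.
Proof.
move=> /continuousP fc; apply: (measurability _ (measurable_realfun.RGenOpens.measurableE R)).
move=> _ [_ [a [b ->] <-]]; rewrite setTI; apply: sub_sigma_algebra.
by apply: fc; exact: interval_open.
Qed.

Lemma measurable_coset : measurable_fun setT (@coset R d).
Proof.
apply: (@measurability _ _ _ _ _ _ (@open T)) => //.
by move=> _ [U oU <-]; rewrite setTI; apply: sub_sigma_algebra.
Qed.

Lemma measurable_translation x : measurable_fun setT (fun y : T => x + y).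
Proof.
apply: (@measurability _ _ _ _ _ _ (@open T)) => //.
move=> _ [U oU <-]; rewrite setTI; apply: sub_sigma_algebra.
rewrite torus_openE; rewrite (_ : _ @^-1` _ = (fun u => repr x + u) @^-1` (\pi_T @^-1` U)).
  move: oU; rewrite torus_openE; apply: open_comp => u _.
  by apply: continuousD; [exact: cst_continuous|exact: cvg_id].
by apply/funext => u /=; rewrite torus_piD reprK.
Qed.

End torus_theory.

(** * Integration against Haar measure *)

Section bounded_functions.
Context dd (X : measurableType dd) (R : realType).
Variable mu : {finite_measure set X -> \bar R}.

Lemma bounded_integrable (f : X -> R) (C : R) : measurable_fun setT f ->
  (forall x, `|f x| <= C) -> mu.-integrable setT (EFin \o f).
Proof.
move=> mf fC; apply: (@le_integrable _ _ _ mu setT measurableT _ (cst C%:E)).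
- exact/measurable_EFinP.
- by move=> x _; rewrite /= lee_fin (le_trans (fC x))// ler_norm.
- exact: finite_measure_integrable_cst.
Qed.

End bounded_functions.

Section haar.
Variables (R : realType) (d : nat) (lambda : probability (torus R d) R).
Hypothesis haar : is_haar lambda.
Local Notation T := (torus R d).

Section translation.
Variable a : T.
Let phi (x : T) : T := a + x.
Let mphi : measurable_fun setT phi := measurable_translation a.
Let ge0_translation (f : T -> \bar R) : measurable_fun setT f ->
  (forall x, 0 <= f x)%E ->
  (\int[lambda]_x f (a + x)%R = \int[lambda]_x f x)%E.
Proof.
move=> mf f0; rewrite -[in LHS](preimage_setT phi).
rewrite -(@ge0_integral_pushforward _ _ _ _ _ _ mphi lambda _ _ measurableT mf)//.
by apply: eq_measure_integral => A mA _; exact: haar.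
Qed.

Lemma integral_translation (f : T -> \bar R) : measurable_fun setT f ->
  (\int[lambda]_x f (a + x)%R = \int[lambda]_x f x)%E.
Proof.
move=> mf; rewrite [LHS]integralE [RHS]integralE; congr (_ - _)%E.
- transitivity (\int[lambda]_x (f^\+)%E (a + x)%R)%E; last first.
    by apply: ge0_translation => [|x]; [exact: measurable_funepos|exact: funepos_ge0].
  by apply: eq_integral => x _; rewrite !funeposE.
- transitivity (\int[lambda]_x (f^\-)%E (a + x)%R)%E; last first.
    by apply: ge0_translation => [|x]; [exact: measurable_funeneg|exact: funeneg_ge0].
  by apply: eq_integral => x _; rewrite !funenegE.
Qed.

Lemma Rintegral_translation (f : T -> R) : measurable_fun setT f ->
  \int[lambda]_x f (a + x) = \int[lambda]_x f x.
Proof.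
move=> mf; congr fine; apply: (@integral_translation (EFin \o f)).
exact/measurable_EFinP.
Qed.

End translation.

Lemma measurable_cosn n : measurable_fun setT (@cosn R d n).
Proof. by apply: torus_continuous_measurable; exact: continuous_cosn. Qed.

Lemma measurable_sinn n : measurable_fun setT (@sinn R d n).
Proof. by apply: torus_continuous_measurable; exact: continuous_sinn. Qed.


Lemma integrable_cosn (mu : {finite_measure set T -> \bar R}) n :
  mu.-integrable setT (EFin \o @cosn R d n).
Proof.
apply: (bounded_integrable mu (C := 1)) (measurable_cosn n) _ => x; exact: cos_max.
Qed.

Lemma integrable_sinn (mu : {finite_measure set T -> \bar R}) n :
  mu.-integrable setT (EFin \o @sinn R d n).
Proof.
apply: (bounded_integrable mu (C := 1)) (measurable_sinn n) _ => x; exact: sin_max.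
Qed.

(** Translating by half a period in the direction [n] changes the sign of the
character, while the Haar integral does not change. *)
Lemma chi_antiperiod (n : 'rV[int]_d) : n != 0 ->
  exists a : T, forall x, chi n (a + x) = - chi n x.
Proof.
move=> n0; pose v := intvec R n; pose q := dotp v v.
have q0 : 0 < q.
  rewrite lt0r; apply/andP; split; last first.
    by apply: sumr_ge0 => i _; rewrite -expr2 sqr_ge0.
  apply: contra n0; rewrite psumr_eq0; last by move=> i _; rewrite -expr2 sqr_ge0.
  move=> /allP h; apply/eqP/rowP => i; have := h i (mem_index_enum i).
  by rewrite /= mulf_eq0 orbb !mxE intr_eq0 => /eqP.
exists (\pi_T ((2 * q)^-1 *: v)) => x; rewrite chiDr chi_pi.
have -> : dotp (intvec R n) ((2 * q)^-1 *: v) = 2^-1.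
  rewrite /dotp (eq_bigr (fun i => (2 * q)^-1 * (v ord0 i * v ord0 i))).
    rewrite -mulr_sumr -/(dotp v v) -/q; field; exact: lt0r_neq0.
  by move=> i _; rewrite [X in _ * X]mxE mulrCA.
rewrite (_ : 2 * pi * 2^-1 = pi); last by field.
have -> : cis pi = -1 :> R[i].
  by rewrite /cis cospi sinpi; apply: complex_ext; rewrite /= ?oppr0.
by rewrite mulN1r.
Qed.

Lemma Rintegral_chi_eq0 (n : 'rV[int]_d) : n != 0 ->
  \int[lambda]_x cosn n x = 0 /\ \int[lambda]_x sinn n x = 0.
Proof.
move=> /chi_antiperiod[a an].
have zero (f : T -> R) : measurable_fun setT f -> lambda.-integrable setT (EFin \o f) ->
    (forall x, f (a + x) = - f x) -> \int[lambda]_x f x = 0.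
  move=> mf fi fa; have := Rintegral_translation a mf.
  under eq_Rintegral do rewrite fa -mulN1r.
  by rewrite RintegralZl//; lra.
split; apply: zero; [exact: measurable_cosn|exact: integrable_cosn|
  |exact: measurable_sinn|exact: integrable_sinn|] => x.
- by have [] := an x.
- by have [] := an x.
Qed.

Lemma Rintegral_cosn (n : 'rV[int]_d) : \int[lambda]_x cosn n x = (n == 0)%:R.
Proof.
have [->|/Rintegral_chi_eq0[]//] := eqVneq.
rewrite (@eq_Rintegral _ _ _ _ _ (cst 1)); last by move=> x _; have [] := @chi0l R d x.
by rewrite Rintegral_cst//= [X in fine X](@probability_setT _ _ _ lambda) mulr1.
Qed.

Lemma Rintegral_sinn (n : 'rV[int]_d) : \int[lambda]_x sinn n x = 0.
Proof.
have [->|/Rintegral_chi_eq0[]//] := eqVneq n 0.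
rewrite (@eq_Rintegral _ _ _ _ _ (cst 0)); last by move=> x _; have [] := @chi0l R d x.
by rewrite Rintegral_cst// mul0r.
Qed.

End haar.

(** * Polynomial approximation of an indicator *)

Section step_approximation.
Variable R : realType.
Implicit Types t : R.

Lemma bernoulli_ge t (n : nat) : 0 <= t -> t <= 1 -> 1 - n%:R * t <= (1 - t) ^+ n.
Proof.
move=> t0 t1; elim: n => [|n IH]; first by rewrite mul0r subr0 expr0.
rewrite exprS -natr1; apply: (@le_trans _ _ ((1 - t) * (1 - n%:R * t))).
  rewrite -subr_ge0 (_ : _ - _ = n%:R * t ^+ 2) ?mulr_ge0 ?sqr_ge0//; ring.
by rewrite ler_wpM2l ?subr_ge0.
Qed.

Lemma bernoulli_inv t (n : nat) : 0 <= t -> t <= 1 -> (1 - t) ^+ n * (n%:R * t) <= 1.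
Proof.
move=> t0 t1; have p0 : 0 <= (1 - t) ^+ n by rewrite exprn_ge0 ?subr_ge0.
apply: (@le_trans _ _ ((1 - t) ^+ n * (1 + t) ^+ n)).
  apply: ler_wpM2l => //; elim: n {p0} => [|n IH]; first by rewrite mul0r expr0.
  rewrite exprS mulrDl mul1r -natr1 mulrDl mul1r; apply: lerD => //.
  by rewrite ler_peMr// exprn_ege1// lerDl.
rewrite -exprMn exprn_ile1//.
  by rewrite mulr_ge0 ?subr_ge0// addr_ge0.
by rewrite -subr_ge0 (_ : _ - _ = t ^+ 2) ?sqr_ge0//; ring.
Qed.

(** Polynomials that stay in [0, 1] on [0, 1] and converge there to the
indicator of [0, 1/2): the first factor, from the lemma of Brosowski and Deutsch
behind the theorem of Stone and Weierstrass, has the right limit off [1/2], and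
the second one kills the point [1/2]. *)
Definition step_poly (n : nat) t : R :=
  (1 - t ^+ n) ^+ (2 ^ n) * (1 - (1 - (t - 2^-1) ^+ 2) ^+ n).

Lemma step_poly_itv (n : nat) t : 0 <= t -> t <= 1 -> 0 <= step_poly n t <= 1.
Proof.
move=> t0 t1; have tn0 : 0 <= t ^+ n by rewrite exprn_ge0.
have tn1 : t ^+ n <= 1 by rewrite exprn_ile1.
have s0 : 0 <= 1 - (t - 2^-1) ^+ 2.
  have -> : 1 - (t - 2^-1) ^+ 2 = 3 / 4 + t * (1 - t) by field.
  by rewrite addr_ge0 ?divr_ge0 ?mulr_ge0 ?subr_ge0.
have s1 : 1 - (t - 2^-1) ^+ 2 <= 1 by rewrite gerBl sqr_ge0.
have a0 : 0 <= (1 - t ^+ n) ^+ (2 ^ n) by rewrite exprn_ge0 ?subr_ge0.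
have a1 : (1 - t ^+ n) ^+ (2 ^ n) <= 1 by rewrite exprn_ile1 ?subr_ge0 ?gerBl.
have b0 : 0 <= (1 - (t - 2^-1) ^+ 2) ^+ n by rewrite exprn_ge0.
have b1 : (1 - (t - 2^-1) ^+ 2) ^+ n <= 1 by rewrite exprn_ile1.
by rewrite /step_poly mulr_ge0 ?subr_ge0//= mulr_ile1 ?subr_ge0 ?gerBl.
Qed.

Lemma step_poly_cvg t : 0 <= t -> t <= 1 ->
  step_poly ^~ t @ \oo --> ((t < 2^-1)%R%:R : R).
Proof.
move=> t0 t1; have [th|th|->] := ltgtP t 2^-1.
- rewrite -[X in _ --> X]mulr1; apply: cvgM.
    apply: (@squeeze_cvgr _ _ _ _ (fun n => 1 - (2 * t) ^+ n) (cst 1)).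
    + apply: nearW => n; rewrite [X in _ && X]exprn_ile1 ?subr_ge0 ?exprn_ile1//; last first.
        by rewrite gerBl exprn_ge0.
      by rewrite andbT exprMn -natrX bernoulli_ge ?exprn_ge0 ?exprn_ile1.
    + rewrite -[X in _ --> X]subr0; apply: cvgB; first exact: cvg_cst.
      by apply: cvg_expr; rewrite ger0_norm ?mulr_ge0//; lra.
    + exact: cvg_cst.
  rewrite -[X in _ --> X]subr0; apply: cvgB; first exact: cvg_cst.
  apply: cvg_expr; rewrite ger0_norm; last first.
    have -> : 1 - (t - 2^-1) ^+ 2 = 3 / 4 + t * (1 - t) by field.
    by rewrite addr_ge0 ?divr_ge0 ?mulr_ge0 ?subr_ge0.
  by rewrite gtrBl exprn_even_gt0//= subr_eq0 lt_eqF.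
- have t2 : 1 < 2 * t by lra.
  apply: (@squeeze_cvgr _ _ _ _ (cst 0) (fun n => ((2 * t)^-1) ^+ n)).
  + apply: nearW => n; have /andP[-> _] /= := step_poly_itv n t0 t1.
    apply: (@le_trans _ _ ((1 - t ^+ n) ^+ (2 ^ n))).
      rewrite ler_piMr ?exprn_ge0 ?subr_ge0 ?exprn_ile1// gerBl exprn_ge0//.
      have -> : 1 - (t - 2^-1) ^+ 2 = 3 / 4 + t * (1 - t) by field.
      by rewrite addr_ge0 ?divr_ge0 ?mulr_ge0 ?subr_ge0.
    rewrite exprVn -[leRHS]mul1r ler_pdivlMr ?exprn_gt0 ?(lt_trans ltr01)//.
    by rewrite exprMn -natrX bernoulli_inv ?exprn_ge0 ?exprn_ile1.
  + exact: cvg_cst.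
  + apply: cvg_expr; rewrite ger0_norm ?invr_ge0 ?mulr_ge0//.
    by rewrite invf_lt1 ?(lt_trans ltr01).
- rewrite (_ : step_poly ^~ _ = cst 0); first exact: cvg_cst.
  apply/funext => n; rewrite /step_poly subrr expr0n /= subr0 expr1n subrr.
  by rewrite mulr0.
Qed.

End step_approximation.

(** * Integrals of real functions *)

Section Rdominated.
Context dd (X : measurableType dd) (R : realType).
Variable mu : {measure set X -> \bar R}.

Lemma Rdominated_cvg (f_ : nat -> X -> R) (f g : X -> R) :
  (forall n, measurable_fun setT (f_ n)) ->
  (forall x, f_ ^~ x @ \oo --> f x) ->
  mu.-integrable setT (EFin \o g) ->
  (forall n x, `|f_ n x| <= g x) ->
  mu.-integrable setT (EFin \o f) /\
  (fun n => \int[mu]_x f_ n x) @ \oo --> \int[mu]_x f x.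
Proof.
move=> mf_ f_f ig fg.
have mf : measurable_fun setT f by apply: measurable_fun_cvg mf_ _ => x _; exact: f_f.
have [||||fi _ fc] := @dominated_convergence _ _ _ mu setT measurableT
    (fun n => EFin \o f_ n) (EFin \o f) (EFin \o g) _ _ _ ig.
- by move=> n; exact/measurable_EFinP.
- exact/measurable_EFinP.
- by apply: aeW => x _ /=; apply/cvg_EFin; [exact: nearW|exact: f_f].
- by apply: aeW => x n _ /=; rewrite lee_fin.
split => //; apply: fine_cvg; rewrite /Rintegral fineK//.
exact: integrable_fin_num.
Qed.

End Rdominated.

Section real_integrals.
Context dd (X : measurableType dd) (R : realType).
Variable mu : {measure set X -> \bar R}.
Local Notation integrableR f := (mu.-integrable setT (EFin \o f)).

Lemma integrableRZ (a : R) (g : X -> R) : integrableR g -> integrableR (fun x => a * g x).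
Proof. by move=> gi; apply: (eq_integrable _ _ _ _ (integrableZl measurableT a gi)). Qed.

Lemma integrableRD (g h : X -> R) : integrableR g -> integrableR h ->
  integrableR (fun x => g x + h x).
Proof. by move=> gi hi; apply: (eq_integrable _ _ _ _ (integrableD measurableT gi hi)). Qed.

Lemma integrableRM_bounded (C : R) (g h : X -> R) : integrableR h ->
  measurable_fun setT g -> (forall x, `|g x| <= C) -> integrableR (fun x => h x * g x).
Proof.
move=> hi mg gC; have mh : measurable_fun setT h.
  by apply/measurable_EFinP; exact: measurable_int hi.
have := integrableRZ C (integrable_norm hi : integrableR (fun x => `|h x|)).
apply: (le_integrable measurableT).
  by apply/measurable_EFinP; exact: measurable_funM.
move=> x _; rewrite /= lee_fin normrM mulrC.
by apply: le_trans (ler_norm _); exact: ler_wpM2r.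
Qed.

Lemma Rintegral_sum_ord n (f : nat -> X -> R) : (forall k, integrableR (f k)) ->
  integrableR (fun x => \sum_(k < n) f k x) /\
  \int[mu]_x (\sum_(k < n) f k x) = \sum_(k < n) \int[mu]_x f k x.
Proof.
move=> fi; elim: n => [|n [IH1 IH2]].
  have -> : (fun x => \sum_(k < 0) f k x) = cst 0 by apply/funext => x; rewrite big_ord0.
  rewrite big_ord0 /Rintegral /= integral0; split => //.
  exact: integrable0.
have E : (fun x => \sum_(k < n.+1) f k x) = (fun x => \sum_(k < n) f k x + f n x).
  by apply/funext => x; rewrite big_ord_recr.
rewrite E big_ord_recr /= -IH2 RintegralD//; split => //.
exact: integrableRD.
Qed.

(** Dominated convergence: [C * |h|] bounds the products of [h] with the partial
sums. *)
Lemma bounded_series_integral (h Phi : X -> R) (phi : nat -> X -> R) (C : R) :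
  integrableR h -> (forall k, measurable_fun setT (phi k)) ->
  (forall n x, `|\sum_(k < n) phi k x| <= C) ->
  (forall x, (fun n => \sum_(k < n) phi k x) @ \oo --> Phi x) ->
  (fun n => \sum_(k < n) \int[mu]_x (h x * phi k x)) @ \oo --> \int[mu]_x (h x * Phi x).
Proof.
move=> hi mphi phiC phiPhi; have mh : measurable_fun setT h.
  by apply/measurable_EFinP; exact: measurable_int hi.
have hphi k : integrableR (fun x => h x * phi k x).
  apply: (@integrableRM_bounded (C + C)) => // x.
  have -> : phi k x = \sum_(j < k.+1) phi j x - \sum_(j < k) phi j x.
    by rewrite big_ord_recr /= addrAC subrr add0r.
  by apply: le_trans (ler_normB _ _) _; exact: lerD.
under eq_fun do rewrite -(Rintegral_sum_ord _ hphi).2.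
have [||||_] := @Rdominated_cvg _ _ _ mu (fun n x => \sum_(k < n) h x * phi k x)
  (fun x => h x * Phi x) (fun x => C * `|h x|); last exact.
- move=> n; apply: measurable_sum => k; exact: measurable_funM.
- move=> x; under eq_fun do rewrite -mulr_sumr; apply: cvgMl_tmp; exact: phiPhi.
- apply: integrableRZ; exact: integrable_norm.
- by move=> n x; rewrite -mulr_sumr normrM mulrC ler_wpM2r.
Qed.

End real_integrals.


(** * Trigonometric polynomials generate the Borel sets *)

Section trigonometric_polynomials.
Variables (R : realType) (d : nat).
Local Notation T := (torus R d).
Implicit Types (x y : T) (n : 'rV[int]_d) (f g : T -> R).

Definition trig_poly f := exists s : seq (R[i] * 'rV[int]_d),
  forall x, (f x)%:C = \sum_(p <- s) p.1 * chi p.2 x.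

Lemma trig_poly_cst (c : R) : trig_poly (cst c).
Proof. by exists [:: (c%:C, 0)] => x; rewrite big_seq1 /= chi0l mulr1. Qed.

Lemma trig_polyD f g : trig_poly f -> trig_poly g -> trig_poly (fun x => f x + g x).
Proof.
by move=> [s fs] [t gt]; exists (s ++ t) => x; rewrite big_cat -fs -gt rmorphD.
Qed.

Lemma trig_polyM f g : trig_poly f -> trig_poly g -> trig_poly (fun x => f x * g x).
Proof.
move=> [s fs] [t gt]; exists [seq (a.1 * b.1, a.2 + b.2) | a <- s, b <- t] => x.
rewrite rmorphM /= fs gt big_distrlr big_allpairs_dep /=.
apply: eq_bigr => a _; apply: eq_bigr => b _.
by rewrite chiDl mulrACA.
Qed.

Lemma trig_polyX f k : trig_poly f -> trig_poly (fun x => f x ^+ k).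
Proof.
move=> tf; elim: k => [|k IH]; first by under eq_fun do rewrite expr0; exact: trig_poly_cst.
by under eq_fun do rewrite exprS; exact: trig_polyM.
Qed.

Lemma trig_polyB f g : trig_poly f -> trig_poly g -> trig_poly (fun x => f x - g x).
Proof.
move=> tf tg; under eq_fun do rewrite -mulN1r.
by apply: trig_polyD => //; apply: trig_polyM => //; exact: trig_poly_cst.
Qed.

Lemma trig_poly_sum (I : Type) (s : seq I) (F : I -> T -> R) :
  (forall i, trig_poly (F i)) -> trig_poly (fun x => \sum_(i <- s) F i x).
Proof.
move=> tF; elim: s => [|i s IH].
  by under eq_fun do rewrite big_nil; exact: trig_poly_cst.
by under eq_fun do rewrite big_cons; exact: trig_polyD.
Qed.

Lemma trig_poly_cosn n : trig_poly (cosn n).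
Proof.
exists [:: ((2^-1)%:C, n); ((2^-1)%:C, - n)] => x.
rewrite big_cons big_seq1 /= chiNl chiE.
by apply: complex_ext; rewrite ?(cReD, cImD, cReM, cImM) /=; field.
Qed.

Lemma trig_poly_sinn n : trig_poly (sinn n).
Proof.
exists [:: (0 -i* (2^-1), n); (0 +i* (2^-1), - n)] => x.
rewrite big_cons big_seq1 /= chiNl chiE.
by apply: complex_ext; rewrite ?(cReD, cImD, cReM, cImM) /=; field.
Qed.

Lemma trig_poly_step f k : trig_poly f -> trig_poly (fun x => step_poly k (f x)).
Proof.
move=> tf; rewrite /step_poly; apply: trig_polyM.
  by apply/trig_polyX/trig_polyB; [exact: trig_poly_cst|exact: trig_polyX].
apply: trig_polyB; first exact: trig_poly_cst.
apply/trig_polyX/trig_polyB; first exact: trig_poly_cst.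
by apply/trig_polyX/trig_polyB => //; exact: trig_poly_cst.
Qed.

Lemma trig_polyE f : trig_poly f -> exists s : seq (R * R * 'rV[int]_d),
  f = fun x => \sum_(p <- s) (p.1.1 * cosn p.2 x + p.1.2 * sinn p.2 x).
Proof.
move=> [s fs]; exists [seq ((complex.Re p.1, - complex.Im p.1), p.2) | p <- s].
apply/funext => x; have := congr1 (@complex.Re R) (fs x).
rewrite cRe_sum /= => ->; rewrite big_map; apply: eq_bigr => p _ /=.
by rewrite cReM chiE /= mulNr.
Qed.

Lemma trig_poly_measurable f : trig_poly f -> measurable_fun setT f.
Proof.
move=> /trig_polyE[s ->]; apply: measurable_sum => p.
by apply: measurable_funD; apply: measurable_funM => //;
  [exact: measurable_cosn|exact: measurable_sinn].
Qed.

(** Indicators that are bounded limits of trigonometric polynomials; they are closed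
under intersection because products of trigonometric polynomials are again such. *)
Definition trig_limit (A : set T) := measurable A /\
  exists p : nat -> T -> R,
    [/\ forall k, trig_poly (p k), forall k x, 0 <= p k x <= 1 &
        forall x, p ^~ x @ \oo --> (\1_A x : R)].

Lemma trig_limitI : setI_closed trig_limit.
Proof.
move=> A B [mA [p [tp p01 pA]]] [mB [q [tq q01 qB]]].
split; first exact: measurableI.
exists (fun k x => p k x * q k x); split.
- by move=> k; exact: trig_polyM.
- move=> k x; have /andP[p0 p1] := p01 k x; have /andP[q0 q1] := q01 k x.
  by rewrite mulr_ge0//= mulr_ile1.
- by move=> x; rewrite indicI; apply: cvgM; [exact: pA|exact: qB].
Qed.

Lemma trig_limit_lt_half f : trig_poly f -> (forall x, 0 <= f x <= 1) ->
  trig_limit [set x | f x < 2^-1].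
Proof.
move=> tf f01; split.
  have := trig_poly_measurable tf measurableT (measurable_itv `]-oo, 2^-1[).
  by rewrite setTI; congr measurable; apply/seteqP; split => x /=; rewrite in_itv.
exists (fun k x => step_poly k (f x)); split.
- by move=> k; exact: trig_poly_step.
- by move=> k x; have /andP[? ?] := f01 x; exact: step_poly_itv.
- move=> x; have /andP[? ?] := f01 x.
  by rewrite indicE mem_setE; exact: step_poly_cvg.
Qed.

End trigonometric_polynomials.

Section torus_base.
Variables (R : realType) (d : nat).
Local Notation T := (torus R d).
Local Notation rV := 'rV[R]_d.

(** The cosine is close to 1 only near the integer periods: this is what makes [bump]
small only near its centre modulo the lattice. *)
Lemma cos_near1 (eta : R) : 0 < eta -> exists2 eps : R, 0 < eps &
  forall s : R, 1 - cos (2 * pi * s) < eps ->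
    exists2 k : R, k \is a Num.int & `|s - k| < eta.
Proof.
move=> eta0; pose h := Num.min eta (2^-1).
have h0 : 0 < h by rewrite lt_min eta0 invr_gt0 ltr0n.
have h2 : h <= 2^-1 by rewrite ge_min lexx orbT.
have pi0 := pi_gt0 R.
have hpi (t : R) : 0 <= t -> t <= 2^-1 -> 2 * pi * t \in `[0, pi].
  move=> t0 t2; rewrite in_itv /= mulr_ge0 ?mulr_ge0 ?(ltW pi0)//=.
  by rewrite mulrAC -[leRHS]mul1r ler_pM2r//; lra.
exists (1 - cos (2 * pi * h)).
  have z0 : (0 : R) \in `[0, pi] by rewrite in_itv /= lexx ltW.
  have z1 : 2 * pi * h \in `[0, pi] by apply: hpi => //; exact: ltW.
  by rewrite subr_gt0 -[ltRHS]cos0 ltr_cos//; apply: mulr_gt0 => //; exact: mulr_gt0.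
move=> s hs; exists (Num.floor (s + 2^-1))%:~R; first exact: intr_int.
set k := _%:~R; have kle : k <= s + 2^-1 by exact: ge_floor.
have klt : s + 2^-1 < k + 1 by rewrite /k -intrD1 floorD1_gt.
have sk : `|s - k| <= 2^-1 by rewrite ler_norml; lra.
apply: (@lt_le_trans _ _ h); last by rewrite ge_min lexx.
rewrite ltNge; apply/negP => hsk; move: hs; apply/negP; rewrite -leNgt lerD2l lerN2.
have -> : cos (2 * pi * s) = cos (2 * pi * `|s - k|).
  have -> : 2 * pi * `|s - k| = `|2 * pi * (s - k)|.
    by rewrite normrM ger0_norm ?mulr_ge0 ?(ltW pi0).
  rewrite cos_norm mulrBr.
  have [E _] : cis (2 * pi * s - 2 * pi * k) = cis (2 * pi * s).
    have kZ : - k \is a Num.int by rewrite /k -intrN intr_int.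
    by rewrite cisD -mulrN (cis_int kZ) mulr1.
  by rewrite -E.
have [->//|hne] := eqVneq h `|s - k|.
by apply: ltW; rewrite ltr_cos ?hpi ?(ltW h0)// ltr_pM2l ?mulr_gt0// lt_neqAle hne.
Qed.

Definition bump (a x : T) : R := \sum_(i < d) (1 - cosn (delta_mx ord0 i) (x - a)).

Lemma dotp_delta (i : 'I_d) (u : rV) : dotp (intvec R (delta_mx ord0 i)) u = u ord0 i.
Proof.
rewrite /dotp (bigD1 i)//= big1 ?addr0; first by rewrite !mxE !eqxx mul1r.
by move=> j ji; rewrite !mxE eqxx /= (negPf ji) mul0r.
Qed.

Lemma trig_poly_bump a : trig_poly (bump a).
Proof.
apply: trig_poly_sum => i; apply: trig_polyB; first exact: trig_poly_cst.
rewrite (_ : (fun x : T => _) = fun x : T =>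
   cosn (delta_mx ord0 i) x * cosn (delta_mx ord0 i) a +
   sinn (delta_mx ord0 i) x * sinn (delta_mx ord0 i) a); last first.
  by apply/funext => x; exact: cosn_sub.
apply: trig_polyD; apply: trig_polyM; try exact: trig_poly_cst.
- exact: trig_poly_cosn.
- exact: trig_poly_sinn.
Qed.

Lemma bump_bound a x : 0 <= bump a x <= 2 * d%:R.
Proof.
apply/andP; split; first by apply: sumr_ge0 => i _; rewrite subr_ge0 cos_le1.
have -> : 2 * d%:R = \sum_(i < d) 2 :> R by rewrite sumr_const card_ord mulr_natr.
apply: ler_sum => i _; have := cos_geN1 (phase (delta_mx ord0 i) (x - a)).
by rewrite /cosn; lra.
Qed.

(** Rational centres and integer inverse radii keep the family countable. *)
Definition window (a : 'rV[rat]_d) (m : nat) : set T :=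
  [set x | bump (\pi_T (map_mx ratr a)) x < m.+1%:R^-1].

Lemma trig_limit_window a m : trig_limit (window a m).
Proof.
(* [D] bounds the distance from [bump b] to the threshold, so [f] below rescales the
   comparison with the threshold to a comparison with 1/2 of a function in [0, 1]. *)
pose b := \pi_T (map_mx ratr a) : T.
pose D : R := 2 * d%:R + 1.
have D0 : 0 < D by rewrite ltr_wpDl ?mulr_ge0.
have e0 : 0 < m.+1%:R^-1 :> R by rewrite invr_gt0 ltr0n.
have e1 : m.+1%:R^-1 <= 1 :> R by rewrite invf_le1 ?ltr0n// ler1n.
rewrite /window; move: (m.+1%:R^-1 : R) e0 e1 => e e0 e1.
pose f x := 2^-1 + (bump b x - e) * (2 * D)^-1.
rewrite (_ : [set x | _] = [set x | f x < 2^-1]); last first.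
  apply/seteqP; split => x /=; rewrite /f /= gtrDl pmulr_llt0 ?invr_gt0 ?mulr_gt0//;
  by rewrite subr_lt0.
apply: trig_limit_lt_half.
  apply: trig_polyD; first exact: trig_poly_cst.
  apply: trig_polyM; last exact: trig_poly_cst.
  by apply: trig_polyB; [exact: trig_poly_bump|exact: trig_poly_cst].
move=> x; have /andP[b0 b1] := bump_bound b x.
have D2 : (2 * D)^-1 * D = 2^-1 by rewrite invfM mulfVK ?gt_eqF.
have i0 : 0 < (2 * D)^-1 by rewrite invr_gt0 mulr_gt0.
have up : (2 * D)^-1 * (bump b x - e) <= 2^-1.
  by rewrite -D2 ler_pM2l// /D; lra.
have lo : - 2^-1 <= (2 * D)^-1 * (bump b x - e).
  by rewrite -D2 -mulrN ler_pM2l// /D; have := ler0n R d; lra.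
by rewrite /f [_ * (2 * D)^-1]mulrC; lra.
Qed.

Lemma bump_pi (u v : rV) :
  bump (\pi_T u) (\pi_T v) = \sum_(i < d) (1 - cos (2 * pi * (v ord0 i - u ord0 i))).
Proof.
apply: eq_bigr => i _; rewrite -torus_piN -torus_piD cosn_pi dotp_delta.
by rewrite mxE [(- u) _ _]mxE.
Qed.

(** A rational point close to a lift of [x] serves as centre: after an integer
translation, the lifts of the points of a small window around it lie in a given
sup-norm ball around the lift of [x]. *)
Lemma window_base (U : set T) x : open U -> U x ->
  exists a m, window a m x /\ window a m `<=` U.
Proof.
rewrite torus_openE => oU Ux; pose u := repr x.
have [eta /= eta0 uU] : exists2 eta : R, 0 < eta & ball u eta `<=` (\pi_T @^-1` U : set rV).
  have : nbhs u (\pi_T @^-1` U : set rV) by apply: open_nbhs_nbhs; split => //=; rewrite reprK.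
  by move=> /nbhs_ballP[e e0 eU]; exists e.
have eta2 : 0 < eta / 2 by rewrite divr_gt0.
have [eps eps0 epsP] := cos_near1 eta2.
pose m := Num.truncn eps^-1.
have m0 : 0 < m.+1%:R^-1 :> R by rewrite invr_gt0 ltr0n.
have meps : m.+1%:R^-1 <= eps.
  by rewrite -[leRHS]invrK lef_pV2 ?posrE ?ltr0n ?invr_gt0//; apply/ltW/truncnS_gt.
have d1 : 0 < d%:R + 1 :> R by rewrite ltr_wpDl.
have [del del0 delP] : exists2 del : R, 0 < del &
    forall s : R, `|s| < del -> 1 - cos (2 * pi * s) < m.+1%:R^-1 / (d%:R + 1).
  have : (fun s : R => cos (2 * pi * s)) @ 0 --> cos (2 * pi * 0 : R).
    apply: (@continuous_comp _ _ _ (fun s : R => 2 * pi * s) (@cos R)).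
      by apply: continuousM; [exact: cst_continuous|exact: cvg_id].
    exact: continuous_cos.
  have md : 0 < m.+1%:R^-1 / (d%:R + 1) :> R by rewrite divr_gt0.
  rewrite mulr0 cos0 => /cvgrPdist_lt/(_ _ md)/nbhs_ballP[e /= e0 eP].
  exists e => // s se; apply: le_lt_trans (ler_norm _) _; apply: eP.
  by rewrite /ball /= sub0r normrN.
have /all_sig[a aP] : forall i : 'I_d,
    {q : rat | `|u ord0 i - ratr q| < Num.min del (eta / 2)}.
  move=> i; apply: cid.
  have /rat_in_itvoo[q] : u ord0 i - Num.min del (eta / 2) < u ord0 i + Num.min del (eta / 2).
    by rewrite -subr_gt0 opprD opprK addrACA subrr add0r addr_gt0// lt_min del0.
  rewrite in_itv /= => /andP[q1 q2]; exists q.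
  by rewrite ltr_norml; apply/andP; split; lra.
pose av : 'rV[rat]_d := \row_i a i.
have avE i : (map_mx ratr av : rV) ord0 i = ratr (a i) by rewrite !mxE.
exists av, m; split.
  rewrite /window /= -(reprK x) bump_pi.
  have [d0|d0] := posnP d.
    by rewrite big1 // => i; exfalso; have := ltn_ord i; rewrite {2}d0.
  apply: (@le_lt_trans _ _ (\sum_(i < d) m.+1%:R^-1 / (d%:R + 1))).
    apply: ler_sum => i _; apply: ltW; rewrite avE; apply: delP.
    by apply: lt_le_trans (aP i) _; rewrite ge_min lexx.
  rewrite sumr_const card_ord -[X in X < _]mulr_natl mulrCA gtr_pMr//.
  by rewrite ltr_pdivrMr// mul1r ltrDl.
move=> y; rewrite /window /= -(reprK y); set v := repr y.
rewrite bump_pi => yW.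
have /all_sig2[k kZ kP] : forall i : 'I_d,
    {k : R | k \is a Num.int & `|v ord0 i - ratr (a i) - k| < eta / 2}.
  move=> i; apply: cid2; apply: epsP; apply: le_lt_trans (lt_le_trans yW meps).
  rewrite (bigD1 i)//= avE lerDl; apply: sumr_ge0 => j _.
  by rewrite subr_ge0 cos_le1.
pose kv : rV := \row_i k i.
have -> : \pi_T v = \pi_T (v - kv) :> T.
  by rewrite torus_piD torus_piN (torus_pi_lattice (u := kv)) ?subr0// => i; rewrite mxE.
apply: uU; split => // i j; rewrite ord1 /ball /= !mxE.
have := kP j; have := aP j; rewrite lt_min => /andP[_ h1] h2.
have -> : u ord0 j - (v ord0 j - k j) =
    (u ord0 j - ratr (a j)) - (v ord0 j - ratr (a j) - k j).
  by ring.
by apply: le_lt_trans (ler_normB _ _) _; rewrite [eta]splitr ltrD.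
Qed.

Lemma torus_measurable_trig_limit : @measurable _ T = <<s @trig_limit R d >>.
Proof.
apply/seteqP; split.
  apply: smallest_sub; first exact: smallest_sigma_algebra.
  move=> U oU.
  pose F (p : 'rV[rat]_d * nat) :=
    if `[< window p.1 p.2 `<=` U >] then window p.1 p.2 else set0.
  have -> : U = \bigcup_p F p.
    apply/seteqP; split => [x Ux|x [p _]].
      have [a [m [xW WU]]] := window_base oU Ux.
      by exists (a, m) => //; rewrite /F /=; case: asboolP.
    by rewrite /F; case: asboolP => // /[apply].
  apply: (@countable_bigcupT_measurable _ (g_sigma_algebraType (@trig_limit R d))) => // p.
  rewrite /F; case: asboolP => _; last exact: measurable0.
  by apply: sub_sigma_algebra; exact: trig_limit_window.
apply: smallest_sub; first exact: sigma_algebra_measurable.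
by move=> A [].
Qed.

End torus_base.

(** * Uniqueness of Fourier coefficients *)

Section fourier_uniqueness.
Variables (R : realType) (d : nat).
Local Notation T := (torus R d).
Variables (mu lambda : {finite_measure set T -> \bar R}) (f : T -> R).
Hypothesis fi : lambda.-integrable setT (EFin \o f).
Hypothesis cos_eq : forall n : 'rV[int]_d,
  \int[mu]_x cosn n x = \int[lambda]_x (cosn n x * f x).
Hypothesis sin_eq : forall n : 'rV[int]_d,
  \int[mu]_x sinn n x = \int[lambda]_x (sinn n x * f x).

Let mf : measurable_fun setT f.
Proof. by apply/measurable_EFinP; exact: measurable_int fi. Qed.

Let trig_term (p : R * R * 'rV[int]_d) (x : T) := p.1.1 * cosn p.2 x + p.1.2 * sinn p.2 x.

Let icos_mu n : mu.-integrable setT (EFin \o @cosn R d n) := integrable_cosn mu n.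
Let isin_mu n : mu.-integrable setT (EFin \o @sinn R d n) := integrable_sinn mu n.
Let icos_f n : lambda.-integrable setT (EFin \o (fun x => cosn n x * f x)).
Proof.
under eq_fun do rewrite mulrC.
by apply: (integrableRM_bounded (C := 1) fi) => [|x]; [exact: measurable_cosn|exact: cos_max].
Qed.
Let isin_f n : lambda.-integrable setT (EFin \o (fun x => sinn n x * f x)).
Proof.
under eq_fun do rewrite mulrC.
by apply: (integrableRM_bounded (C := 1) fi) => [|x]; [exact: measurable_sinn|exact: sin_max].
Qed.

Let trig_poly_integral_eq (g : T -> R) : trig_poly g ->
  \int[mu]_x g x = \int[lambda]_x (g x * f x).
Proof.
move=> /trig_polyE[s ->].
suff : [/\ mu.-integrable setT (EFin \o (fun x => \sum_(p <- s) trig_term p x)),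
    lambda.-integrable setT (EFin \o (fun x => (\sum_(p <- s) trig_term p x) * f x)) &
    \int[mu]_x (\sum_(p <- s) trig_term p x) =
    \int[lambda]_x ((\sum_(p <- s) trig_term p x) * f x)] by case.
elim: s => [|p s [IH1 IH2 IH3]].
  have E1 : (fun x => \sum_(p <- [::]) trig_term p x) = cst 0.
    by apply/funext => x; rewrite big_nil.
  have E2 : (fun x => (\sum_(p <- [::]) trig_term p x) * f x) = cst 0.
    by apply/funext => x; rewrite big_nil mul0r.
  rewrite E1 E2; split; try exact: finite_measure_integrable_cst.
  by rewrite !Rintegral_cst// !mul0r.
have E1 : (fun x => \sum_(q <- p :: s) trig_term q x) =
    (fun x => trig_term p x + \sum_(q <- s) trig_term q x).
  by apply/funext => x; rewrite big_cons.
have E2 : (fun x => (\sum_(q <- p :: s) trig_term q x) * f x) =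
    (fun x => (p.1.1 * (cosn p.2 x * f x) + p.1.2 * (sinn p.2 x * f x)) +
       (\sum_(q <- s) trig_term q x) * f x).
  by apply/funext => x; rewrite big_cons !mulrDl !mulrA.
have i1 : mu.-integrable setT (EFin \o trig_term p).
  by apply: integrableRD; exact: integrableRZ.
have i2 : lambda.-integrable setT
    (EFin \o (fun x => p.1.1 * (cosn p.2 x * f x) + p.1.2 * (sinn p.2 x * f x))).
  by apply: integrableRD; exact: integrableRZ.
rewrite E1 E2; split; [exact: integrableRD|exact: integrableRD|].
rewrite (RintegralD measurableT i1 IH1) (RintegralD measurableT i2 IH2) IH3; congr (_ + _).
rewrite RintegralD//; [|exact: integrableRZ|exact: integrableRZ].
rewrite [RHS]RintegralD//; [|exact: integrableRZ|exact: integrableRZ].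
by rewrite !RintegralZl// cos_eq sin_eq.
Qed.

(** A finite measure is determined by its Fourier coefficients, even against a signed
density: both sides agree on trigonometric polynomials, hence on the sets of [trig_limit]
by dominated convergence, and these form a generating pi-system. *)
Theorem fourier_coefficients_density (A : set T) : measurable A ->
  mu A = (\int[lambda]_(x in A) (f x)%:E)%E.
Proof.
have fA B : measurable B -> lambda.-integrable B (EFin \o f).
  by move=> mB; exact: integrableS fi.
have muT : mu setT = (\int[lambda]_x (f x)%:E)%E.
  have := trig_poly_integral_eq (trig_poly_cst d (1 : R)).
  rewrite Rintegral_cst// mul1r; under [in RHS]eq_Rintegral do rewrite mul1r.
  move=> E; have {E} := congr1 (@EFin R) E; rewrite /Rintegral !fineK ?fin_num_measure//.
  exact: integrable_fin_num.
move=> mA; move: (mA); rewrite torus_measurable_trig_limit; move: A {mA}.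
apply: (dynkin_induction (torus_measurable_trig_limit R d)).
- exact: trig_limitI.
- exact: muT.
- move=> A [mA [p [tp p01 pA]]].
  have p1 k x : `|p k x| <= 1.
    by have /andP[h0 h1] := p01 k x; rewrite ger0_norm.
  have mp k : measurable_fun setT (p k) by exact: trig_poly_measurable.
  have [iA c1] := Rdominated_cvg mp pA (finite_measure_integrable_cst mu 1 measurableT) p1.
  have pf1 k x : `|p k x * f x| <= `|f x| by rewrite normrM ler_piMl.
  have [iAf c2] := @Rdominated_cvg _ _ _ lambda (fun k x => p k x * f x)
    (fun x => \1_A x * f x) (fun x => `|f x|)
    (fun k => measurable_funM (mp k) mf)
    (fun x => cvgMr_tmp (b := f x) (pA x)) (integrable_norm fi) pf1.
  have E : \int[mu]_x \1_A x = \int[lambda]_x (\1_A x * f x) :> R.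
    apply: (cvgn_unique c1).
    by under eq_fun do rewrite trig_poly_integral_eq//; exact: c2.
  have {E} := congr1 (@EFin R) E.
  rewrite /Rintegral !fineK; [|exact: integrable_fin_num iAf|exact: integrable_fin_num iA].
  rewrite integral_indic// setIT => ->; rewrite [RHS]integral_mkcond.
  by apply: eq_integral => x _; rewrite /patch indicE; case: ifP => _ /=;
    rewrite ?mul1r ?mul0r.
- move=> A mA IH; have mC := measurableC mA.
  have AC : [disjoint A & ~` A] by rewrite disj_set2E setICr.
  have := muT; rewrite -(setUv A) measureU//; last exact: setICr.
  rewrite integral_setU//; last first.
    by rewrite setUv; apply/measurable_EFinP.
  have fin : (\int[lambda]_(x in A) (f x)%:E)%E \is a fin_num.
    by apply: integrable_fin_num => //; exact: fA.
  have cancel (a b i j : \bar R) : a = i -> i \is a fin_num -> (a + b = i + j)%E -> b = j.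
    by move=> -> ifin /(congr1 (fun z => z - i)%E); rewrite ![(i + _)%E]addeC !addeK.
  exact: cancel IH fin.
- move=> F mF tF IH; have mU : measurable (\bigcup_k F k) by exact: bigcupT_measurable.
  rewrite measure_semi_bigcup// integral_bigcup//; last exact: fA.
  by apply: eq_eseriesr => k _; exact: IH.
Qed.

End fourier_uniqueness.

(** * Completeness of L^2 *)

Section square_integrable.
Context dd (X : measurableType dd) (R : realType).
Variable mu : {measure set X -> \bar R}.
Local Notation dot := (@L2dot _ _ _ mu).

Lemma Lfun2_sqr (f : X -> R) : measurable_fun setT f ->
  (\int[mu]_x (f x ^+ 2)%:E < +oo)%E -> f \in Lfun mu 2%:E.
Proof.
move=> mf foo; rewrite inE; apply/andP; split; first by rewrite inE.
rewrite inE /finite_norm unlock /= poweR_lty//.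
rewrite (eq_integral (fun x => (f x ^+ 2)%:E))// => x _.
by rewrite /= powR_mulrn// real_normK ?num_real.
Qed.

Definition cmeasurable (f : X -> R[i]) :=
  measurable_fun setT (fun x => complex.Re (f x)) /\
  measurable_fun setT (fun x => complex.Im (f x)).

Lemma cmeasurableB f g : cmeasurable f -> cmeasurable g ->
  cmeasurable (fun x => f x - g x).
Proof.
move=> [fr fi] [gr gi]; split.
  by under eq_fun do rewrite cReB; exact: measurable_funB.
by under eq_fun do rewrite cImB; exact: measurable_funB.
Qed.

Lemma measurable_csq f : cmeasurable f -> measurable_fun setT (fun x => csq (f x)).
Proof. by move=> [fr fi]; apply: measurable_funD; exact: measurable_funX. Qed.

Lemma sqfun_measurable (f : sqfun mu) : cmeasurable f.
Proof.
have [fr fi] := sqfunP f.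
by split; [move: fr|move: fi]; rewrite inE => /andP[]; rewrite inE.
Qed.

Lemma sqfun_csq_integrable (f : sqfun mu) :
  mu.-integrable setT (EFin \o (fun x => csq (f x))).
Proof.
have [fr fi] := sqfunP f.
by apply: (eq_integrable _ _ _ _ (integrableD measurableT
  (Lfun2_integrable_sqr fr) (Lfun2_integrable_sqr fi))).
Qed.

Lemma csq_sqintegrable f : cmeasurable f -> (\int[mu]_x (csq (f x))%:E < +oo)%E ->
  f \in sqintegrable mu.
Proof.
move=> mf foo; have mcsq := measurable_csq mf; have [fr fi] := mf.
apply/andP; split; apply: Lfun2_sqr => //; apply: le_lt_trans foo;
  apply: ge0_le_integral => //=.
- by move=> x _; rewrite lee_fin sqr_ge0.
- by apply/measurable_EFinP; exact: measurable_funX.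
- exact/measurable_EFinP.
- by move=> x _; rewrite lee_fin lerDl sqr_ge0.
- by move=> x _; rewrite lee_fin sqr_ge0.
- by apply/measurable_EFinP; exact: measurable_funX.
- exact/measurable_EFinP.
- by move=> x _; rewrite lee_fin lerDr sqr_ge0.
Qed.

Lemma sqnorm_pi (f : sqfun mu) : sqnorm dot (\pi_(L2 mu) f) = \int[mu]_x csq (f x).
Proof.
transitivity (complex.Re (L2dot (\pi_(L2 mu) f) (\pi_(L2 mu) f))) => //.
rewrite L2dot_pi /=; apply: eq_Rintegral => x _.
by rewrite conjCE mulcJ.
Qed.

Lemma csqB z w : csq (z - w) = csq (w - z) :> R.
Proof. by rewrite /csq !cReB -[w - z]opprB; case: z w => [? ?] [? ?] /=; ring. Qed.

Lemma half_sum_le n : \sum_(j < n) (2^-1) ^+ j <= 2 :> R.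
Proof.
suff -> : \sum_(j < n) (2^-1) ^+ j = 2 - 2 * (2^-1) ^+ n :> R.
  by rewrite gerBl mulr_ge0// exprn_ge0.
elim: n => [|n IH]; first by rewrite big_ord0 expr0 mulr1 subrr.
by rewrite big_ord_recr /= IH exprS; field.
Qed.

(** By [2 |x| <= 2^j x^2 + 2^(-j)] the increments are absolutely summable. *)
Lemma weighted_square_cvg (a : nat -> R) :
  (\sum_(0 <= j <oo) (2 ^+ j * (a j.+1 - a j) ^+ 2)%:E < +oo)%E -> cvgn a.
Proof.
move=> foo; set S := (\sum_(0 <= j <oo) _)%E in foo.
have t0 (j : nat) : 0 <= 2 ^+ j * (a j.+1 - a j) ^+ 2 by rewrite mulr_ge0 ?sqr_ge0 ?exprn_ge0.
have S0 : (0 <= S)%E by apply: nneseries_ge0 => j _ _; rewrite lee_fin.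
have Sfin : S \is a fin_num by rewrite ge0_fin_numE.
have Sn n : \sum_(j < n) 2 ^+ j * (a j.+1 - a j) ^+ 2 <= fine S.
  rewrite -lee_fin fineK// -sumEFin.
  rewrite -(big_mkord xpredT (fun j => (2 ^+ j * (a j.+1 - a j) ^+ 2)%:E)).
  by apply: nneseries_lim_ge => j _ _; rewrite lee_fin.
have cvs : cvgn (fun n => \sum_(0 <= j < n) `|telescope a j|).
  apply: nondecreasing_is_cvgn.
    by apply/nondecreasing_seqP => n; rewrite big_nat_recr//= lerDl.
  exists ((fine S + 2) / 2) => _ [n _ <-].
  rewrite big_mkord ler_pdivlMr//.
  apply: le_trans (lerD (Sn n) (half_sum_le n)); rewrite -big_split mulr_suml /=.
  apply: ler_sum => j _; rewrite /telescope /=; set x := a j.+1 - a j.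
  have p0 : 0 < 2 ^+ j :> R by rewrite exprn_gt0.
  rewrite -(ler_pM2r p0) mulrDl exprVn mulVf ?gt_eqF//.
  rewrite -[x ^+ 2]real_normK ?num_real//.
  by have := sqr_ge0 (2 ^+ j * `|x| - 1); move: (2 ^+ j) (`|x|) => p y; lra.
have cs : cvgn (series (telescope a)) by exact: normed_cvg cvs.
rewrite (_ : a = fun n => a 0%N + series (telescope a) n).
  by apply: is_cvgD => //; exact: is_cvg_cst.
by apply/funext => n; exact: eq_sum_telescope.
Qed.

(** Riesz-Fischer. Along a subsequence with increments of squared norm below
[4 ^- j] the series of the [2 ^ j |u_{j+1} - u_j|^2] is integrable, so the
subsequence converges almost everywhere; Fatou's lemma then bounds the distance to
the pointwise limit. *)
Theorem riesz_fischer : complete_dot dot.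
Proof.
move=> s s_cauchy.
have /choice[N NP] : forall j : nat, exists M, forall m n, (M <= m)%N -> (m <= n)%N ->
    sqnorm dot (s n - s m) < (4^-1) ^+ j.
  by move=> j; apply: s_cauchy; rewrite exprn_gt0 ?invr_gt0.
pose phi (j : nat) := (\sum_(i < j.+1) N i)%N.
have phi_ge j : (N j <= phi j)%N by rewrite /phi big_ord_recr /= leq_addl.
have phi_le i j : (i <= j)%N -> (phi i <= phi j)%N.
  move=> /subnKC <-; elim: (j - i)%N => [|k IH]; first by rewrite addn0.
  by rewrite addnS {2}/phi big_ord_recr /= (leq_trans IH)// leq_addr.
pose f n : sqfun mu := repr (s n).
have sE n : s n = \pi_(L2 mu) (f n) by rewrite reprK.
have dist m n : (\int[mu]_x (csq (f n x - f m x))%:E)%E = (sqnorm dot (s n - s m))%:E.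
  rewrite !sE -raddfB sqnorm_pi /Rintegral fineK//.
  by apply: integrable_fin_num => //; exact: sqfun_csq_integrable.
have close j m n : (phi j <= m)%N -> (phi j <= n)%N ->
    (\int[mu]_x (csq (f n x - f m x))%:E <= ((4^-1) ^+ j)%:E)%E.
  move=> jm jn; have [mn|nm] := leqP m n.
    by rewrite dist lee_fin ltW// NP// (leq_trans (phi_ge j)).
  under eq_integral do rewrite csqB.
  by rewrite dist lee_fin ltW// NP// ?(leq_trans (phi_ge j))// ltnW.
pose u j := f (phi j).
have mu_ j : cmeasurable (u j) := sqfun_measurable _.
pose g j x : \bar R := (2 ^+ j * csq (u j.+1 x - u j x))%:E.
have mg j : measurable_fun setT (g j).
  by apply/measurable_EFinP/measurable_funM => //; apply/measurable_csq/cmeasurableB.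
have g0 j x : (0 <= g j x)%E by rewrite lee_fin mulr_ge0 ?exprn_ge0 ?csq_ge0.
pose G x := (\sum_(0 <= j <oo) g j x)%E.
have G0 x : (0 <= G x)%E by apply: nneseries_ge0 => j _ _.
have mG : measurable_fun setT G.
  by apply: ge0_emeasurable_sum => // j x _ _.
have Goo : (\int[mu]_x G x < +oo)%E.
  rewrite integral_nneseries//.
  apply: (@le_lt_trans _ _ (\sum_(0 <= j <oo) ((2^-1) ^+ j)%:E)%E).
    apply: lee_nneseries => [j _ _|j _]; first exact: integral_ge0.
    rewrite /g; under eq_integral do rewrite EFinM.
    rewrite ge0_integralZl//; last 2 first.
    - by apply/measurable_EFinP/measurable_csq/cmeasurableB.
    - by move=> x _; rewrite lee_fin csq_ge0.
    apply: (@le_trans _ _ ((2 ^+ j)%:E * ((4^-1) ^+ j)%:E)%E).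
      by apply: lee_wpmul2l; [rewrite lee_fin exprn_ge0|apply: close => //; exact: phi_le].
    by rewrite -EFinM lee_fin -exprMn (_ : 2 * 4^-1 = 2^-1 :> R)//; field.
  apply: (@le_lt_trans _ _ 2%:E); last by rewrite ltry.
  apply: lime_le; first by apply: is_cvg_nneseries => j _ _; rewrite lee_fin exprn_ge0.
  by apply: nearW => n; rewrite big_mkord sumEFin lee_fin half_sum_le.
have iG : mu.-integrable setT G.
  by apply/integrableP; split => //; under eq_integral do rewrite gee0_abs//.
pose E := [set x | (G x < +oo)%E].
have mE : measurable E by rewrite -[E]setTI; exact: emeasurable_fun_infty_o.
have aeE : {ae mu, forall x, E x}.
  have := integrable_ae measurableT iG; apply: filterS => x /(_ I).
  by rewrite fin_numE /E /= ltey => /andP[].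
(* Cut off outside [E], the sequences converge everywhere, so their limits are
   measurable. *)
pose ur j x := \1_E x * complex.Re (u j x).
pose ui j x := \1_E x * complex.Im (u j x).
have mur j : measurable_fun setT (ur j) by apply: measurable_funM => //; case: (mu_ j).
have mui j : measurable_fun setT (ui j) by apply: measurable_funM => //; case: (mu_ j).
have partcvg (p : R[i] -> R) (x : X) : (forall z w, p (z - w) = p z - p w) ->
    (forall z, p z ^+ 2 <= csq z) -> cvgn (fun j => \1_E x * p (u j x)).
  move=> pB pz; rewrite indicE; case: (boolP (x \in E)) => xE; last first.
    by under eq_fun do rewrite mul0r; exact: is_cvg_cst.
  under eq_fun do rewrite mul1r.
  apply: weighted_square_cvg; apply: le_lt_trans (set_mem xE).
  apply: lee_nneseries => [j _ _|j _].
    by rewrite lee_fin mulr_ge0 ?sqr_ge0 ?exprn_ge0.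
  by rewrite /g lee_fin ler_wpM2l ?exprn_ge0// -pB.
have curx x : cvgn (ur ^~ x).
  by apply: partcvg => [z w|z]; [exact: cReB|rewrite lerDl sqr_ge0].
have cuix x : cvgn (ui ^~ x).
  by apply: partcvg => [z w|z]; [case: z w => [? ?] [? ?]|rewrite lerDr sqr_ge0].
pose r x : R[i] := limn (ur ^~ x) +i* limn (ui ^~ x).
have mr : cmeasurable r.
  by split; [apply: (measurable_fun_cvg mur) => x _; exact: curx
            |apply: (measurable_fun_cvg mui) => x _; exact: cuix].
have bound j n : (phi j <= n)%N ->
    (\int[mu]_x (csq (f n x - r x))%:E <= ((4^-1) ^+ j)%:E)%E.
  move=> jn; pose h i x := (csq (f n x - u i x))%:E.
  have mh i : measurable_fun setT (h i).
    by apply/measurable_EFinP/measurable_csq/cmeasurableB => //; exact: sqfun_measurable.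
  have h0 i x : (0 <= h i x)%E by rewrite lee_fin csq_ge0.
  have hr x : E x -> limn_einf (h ^~ x) = (csq (f n x - r x))%:E.
    move=> Ex; have E1 : \1_E x = 1 :> R by rewrite indicE mem_set.
    suff hx : h ^~ x @ \oo --> (csq (f n x - r x))%:E.
      by rewrite is_cvg_limn_einfE; [exact/cvg_lim|apply/cvg_ex; eexists; exact: hx].
    apply/cvg_EFin; first exact: nearW.
    rewrite /comp /h /csq /=; under eq_fun do rewrite cReB cImB.
    rewrite cReB cImB; have ax := curx x; have bx := cuix x.
    have Eu : ur ^~ x = (fun i => complex.Re (u i x)) by apply/funext => i; rewrite /ur E1 mul1r.
    have Ei : ui ^~ x = (fun i => complex.Im (u i x)) by apply/funext => i; rewrite /ui E1 mul1r.
    apply: cvgD; rewrite !expr2; apply: cvgM; apply: cvgB; try exact: cvg_cst.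
    - by rewrite /r /= Eu; rewrite Eu in ax.
    - by rewrite /r /= Eu; rewrite Eu in ax.
    - by rewrite /r /= Ei; rewrite Ei in bx.
    - by rewrite /r /= Ei; rewrite Ei in bx.
  have mfr : measurable_fun setT (fun x => (csq (f n x - r x))%:E).
    by apply/measurable_EFinP/measurable_csq/cmeasurableB => //; exact: sqfun_measurable.
  rewrite (@ae_eq_integral _ _ _ mu setT (fun x => limn_einf (h ^~ x)) _ measurableT mfr);
    last 2 first.
  - apply: (@measurableT_comp _ _ _ _ _ _ (@oppe R)) => //.
    apply: measurable_fun_limn_esup => i.
    by apply: measurableT_comp.
  - by apply: filterS aeE => x Ex _; rewrite hr.
  apply: le_trans (fatou mu measurableT mh (fun i x _ => h0 i x)) _.
  rewrite limn_einf_lim; apply: lime_le; first exact: is_cvg_einfs.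
  apply: nearW => m; apply: (@le_trans _ _ (\int[mu]_x h (maxn m j) x)%E).
    by apply: ereal_inf_lbound; exists (maxn m j) => //=; exact: leq_maxl.
  under eq_integral do rewrite /h csqB.
  rewrite /u; under eq_integral do rewrite csqB.
  by apply: close => //; apply: phi_le; exact: leq_maxr.
have dL j n : (phi j <= n)%N -> (fun x => f n x - r x) \in sqintegrable mu.
  move=> jn; apply: csq_sqintegrable; first by apply: cmeasurableB => //; exact: sqfun_measurable.
  by apply: le_lt_trans (bound j n jn) _; rewrite ltry.
have rL : r \in sqintegrable mu.
  have -> : r = (f (phi 0) : X -> R[i]) - (fun x => f (phi 0) x - r x).
    by apply/funext => x; rewrite !fctE subKr.
  by rewrite rpredB ?(dL 0%N)//; case: (f (phi 0)).
exists (\pi_(L2 mu) (SqFun rL)).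
apply/cvgrPdist_le => eps eps0.
have : (fun j => (4^-1) ^+ j : R) @ \oo --> (0 : R).
  by apply: cvg_expr; rewrite ger0_norm ?invr_ge0// invf_lt1// ltr1n.
move=> /cvgrPdist_le/(_ eps eps0)[j _ /(_ j (leqnn j))].
rewrite /= sub0r normrN ger0_norm ?exprn_ge0// => jeps.
exists (phi j) => // n /= jn; rewrite sub0r normrN ger0_norm ?sqnorm_ge0//.
apply: le_trans jeps; rewrite -lee_fin; apply: le_trans (bound j n jn).
rewrite sE -raddfB sqnorm_pi /Rintegral fineK//.
by apply: integrable_fin_num => //; exact: sqfun_csq_integrable.
Qed.

End square_integrable.

(** * Convolution with a summable cosine series *)

Section cosine_series.
Variables (R : realType) (d : nat) (c : nat -> R) (S : R) (nu : nat -> 'rV[int]_d).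
Local Notation T := (torus R d).
Hypothesis c_ge0 : forall k, 0 <= c k.
Hypothesis c_sum : (fun n => \sum_(k < n) c k) @ \oo --> S.
Implicit Types (x y z : T) (m : 'rV[int]_d).

Definition cos_partial n x : R := \sum_(k < n) c k * cosn (nu k) x.
Definition cos_series x : R := limn (cos_partial ^~ x).
Local Notation F := cos_series.

Lemma cos_series_cvg x : cos_partial ^~ x @ \oo --> F x.
Proof.
have E : cos_partial ^~ x = series (fun k => c k * cosn (nu k) x).
  by apply/funext => n; rewrite seriesEord.
suff : cvgn (cos_partial ^~ x) by [].
rewrite E; apply: normed_cvg.
apply: (@series_le_cvg _ (fun k => `|c k * cosn (nu k) x|) c) => //.
- by move=> k; rewrite normrM ger0_norm// ler_piMr// cos_max.
- by apply/cvg_ex; exists S; rewrite seriesEord.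
Qed.

Lemma partial_sum_le n : \sum_(k < n) c k <= S.
Proof.
have /cvg_lim <- // := c_sum.
apply: nondecreasing_cvgn_le; last by apply/cvg_ex; exists S.
by apply/nondecreasing_seqP => k; rewrite big_ord_recr /= lerDl.
Qed.

Lemma cos_series_tail n x : `|F x - cos_partial n x| <= S - \sum_(k < n) c k.
Proof.
have h : (fun p => `|cos_partial (n + p) x - cos_partial n x|) @ \oo -->
    `|F x - cos_partial n x|.
  apply: cvg_norm; apply: cvgB; last exact: cvg_cst.
  have := @cos_series_cvg x; rewrite -(cvg_shiftn n).
  by under eq_fun do rewrite addnC.
apply: (cvgr_to_le h); apply: nearW => p.
rewrite /cos_partial; apply: (@le_trans _ _ (\sum_(k < n + p) c k - \sum_(k < n) c k)).
  rewrite !big_split_ord /= ![_ + _ - _]addrAC !subrr !add0r.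
  apply: le_trans (ler_norm_sum _ _ _) _; apply: ler_sum => k _.
  by rewrite normrM ger0_norm// ler_piMr// cos_max.
by rewrite lerD2r partial_sum_le.
Qed.

Lemma cos_partial_le n x : `|cos_partial n x| <= S.
Proof.
apply: le_trans (ler_norm_sum _ _ _) _; apply: le_trans (partial_sum_le n).
by apply: ler_sum => k _; rewrite normrM ger0_norm// ler_piMr// cos_max.
Qed.

Lemma cos_series_le x : `|F x| <= S.
Proof.
apply: (cvgr_to_le (cvg_norm (@cos_series_cvg x))).
by apply: nearW => n; exact: cos_partial_le.
Qed.

Lemma continuous_cos_partial n : continuous (cos_partial n).
Proof.
apply: continuous_big => [|k _]; first exact: add_continuous.
by move=> x; apply: continuousM; [exact: cst_continuous|exact: continuous_cosn].
Qed.

Lemma continuous_cos_series : continuous F.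
Proof.
suff H : continuous (fun u : 'rV[R]_d => F (\pi_T u)) by exact: torus_continuous H.
move=> u; apply: (@cvgrPdist_lt R R _ (nbhs u) (nbhs_filter u)
  (fun u => F (\pi_T u)) (F (\pi_T u))).2 => eps eps0.
have e3 : 0 < eps / 3 by rewrite divr_gt0.
have /cvgrPdist_lt/(_ _ e3)[n _ /(_ n (leqnn n)) /= hn] := c_sum.
have tail y : `|F y - cos_partial n y| < eps / 3.
  by apply: le_lt_trans (cos_series_tail n y) _; apply: le_lt_trans (ler_norm _) hn.
have cont : continuous (fun v : 'rV[R]_d => cos_partial n (\pi_T v)).
  by move=> v; apply: continuous_comp; [exact: continuous_torus_pi|exact: continuous_cos_partial].
have /cvgrPdist_lt/(_ _ e3) := cont u.
apply: filterS => v /=; set x := \pi_T u; set y := \pi_T v => hy.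
have -> : F x - F y = (F x - cos_partial n x) + (cos_partial n x - cos_partial n y)
   - (F y - cos_partial n y) by ring.
apply: le_lt_trans (ler_normB _ _) _.
apply: le_lt_trans (lerD (ler_normD _ _) (lexx _)) _.
by have := tail x; have := tail y; lra.
Qed.

Lemma cos_series0 : F 0 = S.
Proof.
have /cvg_lim <- // := c_sum; congr (limn _); apply/funext => n.
by apply: eq_bigr => k _; have [E _] := @chi0r R d (nu k); rewrite /cosn E mulr1.
Qed.

Lemma measurable_cos_series : measurable_fun setT F.
Proof. exact: torus_continuous_measurable continuous_cos_series. Qed.

Section haar.
Variable lambda : probability T R.
Hypothesis haar : is_haar lambda.

Lemma cosn_mul m p x : cosn m x * cosn p x = (cosn (m + p) x + cosn (m - p) x) / 2.
Proof.
have [E1 _] := chiDl m p x; have [E2 _] := chiDl m (- p) x.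
move: E2; have [-> ->] := chiNl p x => E2.
by rewrite /cosn /sinn in E1 E2 *; rewrite E1 E2; field.
Qed.

Lemma sinn_mul_cosn m p x : sinn m x * cosn p x = (sinn (m + p) x + sinn (m - p) x) / 2.
Proof.
have [_ E1] := chiDl m p x; have [_ E2] := chiDl m (- p) x.
move: E2; have [-> ->] := chiNl p x => E2.
by rewrite /cosn /sinn in E1 E2 *; rewrite E1 E2; field.
Qed.

Lemma Rintegral_halfsum (g h : T -> R) : lambda.-integrable setT (EFin \o g) ->
  lambda.-integrable setT (EFin \o h) ->
  \int[lambda]_x ((g x + h x) / 2) = (\int[lambda]_x g x + \int[lambda]_x h x) / 2.
Proof.
move=> gi hi; rewrite -RintegralD// -RintegralZr//.
by apply: (eq_integrable _ _ _ _ (integrableD measurableT gi hi)).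
Qed.

Lemma Rintegral_cosn_mul m p :
  \int[lambda]_x (cosn m x * cosn p x) = ((m + p == 0)%:R + (m - p == 0)%:R) / 2.
Proof.
under eq_Rintegral do rewrite cosn_mul.
by rewrite Rintegral_halfsum ?Rintegral_cosn//; exact: integrable_cosn.
Qed.

Lemma Rintegral_sinn_mul m p : \int[lambda]_x (sinn m x * cosn p x) = 0.
Proof.
under eq_Rintegral do rewrite sinn_mul_cosn.
by rewrite Rintegral_halfsum ?Rintegral_sinn//; [lra|exact: integrable_sinn|exact: integrable_sinn].
Qed.

Let measurable_cosn_shift m x : measurable_fun setT (fun z : T => cosn m (z - x)).
Proof.
under eq_fun do rewrite cosn_sub.
by apply: measurable_funD; apply: measurable_funM => //;
  [exact: measurable_cosn|exact: measurable_sinn].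
Qed.

Let cos_coef (h : T -> R) k := \int[lambda]_z (h z * cosn (nu k) z).
Let sin_coef (h : T -> R) k := \int[lambda]_z (h z * sinn (nu k) z).

(** With the kernel recentred at [x], the function [h] enters only through an integral
against a fixed kernel, so changing [h] on a null set changes nothing;
[kconv_translate] recovers the form [h (x + y) * F y]. *)
Definition kconv (h : T -> R) x : R := \int[lambda]_z (h z * F (z - x)).

Lemma integrable_mul_cosn (h : T -> R) m : lambda.-integrable setT (EFin \o h) ->
  lambda.-integrable setT (EFin \o (fun z => h z * cosn m z)).
Proof.
move=> hi; apply: (@integrableRM_bounded _ _ _ _ 1) => //; first exact: measurable_cosn.
by move=> x; exact: cos_max.
Qed.

Lemma integrable_mul_sinn (h : T -> R) m : lambda.-integrable setT (EFin \o h) ->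
  lambda.-integrable setT (EFin \o (fun z => h z * sinn m z)).
Proof.
move=> hi; apply: (@integrableRM_bounded _ _ _ _ 1) => //; first exact: measurable_sinn.
by move=> x; exact: sin_max.
Qed.

Lemma kconv_cvg (h : T -> R) x : lambda.-integrable setT (EFin \o h) ->
  (fun n => \sum_(k < n) c k * (cos_coef h k * cosn (nu k) x + sin_coef h k * sinn (nu k) x))
    @ \oo --> kconv h x.
Proof.
move=> hi.
have -> : (fun n => \sum_(k < n) c k *
      (cos_coef h k * cosn (nu k) x + sin_coef h k * sinn (nu k) x)) =
    (fun n => \sum_(k < n) \int[lambda]_z (h z * (c k * cosn (nu k) (z - x)))).
  apply/funext => n; apply: eq_bigr => k _.
  rewrite [RHS](@eq_Rintegral _ _ _ _ _ (fun z =>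
      c k * (cosn (nu k) x * (h z * cosn (nu k) z) + sinn (nu k) x * (h z * sinn (nu k) z)))).
    have ic : lambda.-integrable setT (EFin \o (fun z => cosn (nu k) x * (h z * cosn (nu k) z))).
      by apply: integrableRZ; exact: integrable_mul_cosn.
    have is_ : lambda.-integrable setT (EFin \o (fun z => sinn (nu k) x * (h z * sinn (nu k) z))).
      by apply: integrableRZ; exact: integrable_mul_sinn.
    rewrite RintegralZl//; last exact: integrableRD.
    rewrite RintegralD// !RintegralZl//; [|exact: integrable_mul_sinn|exact: integrable_mul_cosn].
    by rewrite [X in _ * (X + _)]mulrC [X in _ * (_ + X)]mulrC.
  by move=> z _; rewrite cosn_sub; ring.
apply: (@bounded_series_integral _ _ _ lambda h (fun z => F (z - x))
  (fun k z => c k * cosn (nu k) (z - x)) S) => //.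
- by move=> k; apply: measurable_funM.
- by move=> n z; exact: cos_partial_le.
- by move=> z; exact: cos_series_cvg.
Qed.

Let L1 (h : T -> R) := \int[lambda]_z `|h z|.

Let coef_le (h : T -> R) (g : T -> R) : lambda.-integrable setT (EFin \o h) ->
  measurable_fun setT g -> (forall x, `|g x| <= 1) -> `|\int[lambda]_z (h z * g z)| <= L1 h.
Proof.
move=> hi mg g1; have hgi := integrableRM_bounded hi mg g1.
apply: le_trans (le_normr_Rintegral measurableT hgi) _.
apply: le_Rintegral => //; [exact: integrable_norm|exact: integrable_norm|].
by move=> x _; rewrite normrM ler_piMr.
Qed.

Let cos_coef_le h k : lambda.-integrable setT (EFin \o h) -> `|cos_coef h k| <= L1 h.
Proof. by move=> hi; apply: coef_le => // [|x]; [exact: measurable_cosn|exact: cos_max]. Qed.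
Let sin_coef_le h k : lambda.-integrable setT (EFin \o h) -> `|sin_coef h k| <= L1 h.
Proof. by move=> hi; apply: coef_le => // [|x]; [exact: measurable_sinn|exact: sin_max]. Qed.

Let L1_ge0 h : 0 <= L1 h.
Proof. by apply: Rintegral_ge0 => x _. Qed.

Let conv_partial_le h n x : lambda.-integrable setT (EFin \o h) ->
  `|\sum_(k < n) c k * (cos_coef h k * cosn (nu k) x + sin_coef h k * sinn (nu k) x)|
    <= S * (L1 h + L1 h).
Proof.
move=> hi; apply: le_trans (ler_norm_sum _ _ _) _.
apply: (@le_trans _ _ (\sum_(k < n) c k * (L1 h + L1 h))).
  apply: ler_sum => k _; rewrite normrM (ger0_norm (c_ge0 k)) ler_wpM2l//.
  apply: le_trans (ler_normD _ _) _; rewrite !normrM; apply: lerD.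
    by rewrite -[leRHS]mulr1 ler_pM ?cos_coef_le ?cos_max.
  by rewrite -[leRHS]mulr1 ler_pM ?sin_coef_le ?sin_max.
by rewrite -mulr_suml ler_wpM2r ?addr_ge0// partial_sum_le.
Qed.

Lemma measurable_kconv (h : T -> R) : lambda.-integrable setT (EFin \o h) ->
  measurable_fun setT (kconv h).
Proof.
move=> hi; apply: (@measurable_fun_cvg _ _ _ setT (fun n x => \sum_(k < n) c k *
    (cos_coef h k * cosn (nu k) x + sin_coef h k * sinn (nu k) x))) => [n|x _].
  apply: measurable_sum => k; apply: measurable_funM => //.
  by apply: measurable_funD; apply: measurable_funM => //;
    [exact: measurable_cosn|exact: measurable_sinn].
exact: kconv_cvg.
Qed.

Lemma kconv_bounded (h : T -> R) : lambda.-integrable setT (EFin \o h) ->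
  exists C, forall x, `|kconv h x| <= C.
Proof.
move=> hi; exists (S * (L1 h + L1 h)) => x.
apply: (cvgr_to_le (cvg_norm (@kconv_cvg h x hi))).
by apply: nearW => n; exact: conv_partial_le.
Qed.

(** The partial sums of [kconv h] are bounded uniformly in [x], so the pairing with
[g] may be computed term by term; only the Fourier coefficients of [h] and [g]
remain. *)
Lemma kconv_pairing (h g : T -> R) : lambda.-integrable setT (EFin \o h) ->
  lambda.-integrable setT (EFin \o g) ->
  (fun n => \sum_(k < n) c k *
    ((\int[lambda]_x (h x * cosn (nu k) x)) * (\int[lambda]_x (g x * cosn (nu k) x)) +
     (\int[lambda]_x (h x * sinn (nu k) x)) * (\int[lambda]_x (g x * sinn (nu k) x))))
    @ \oo --> \int[lambda]_x (kconv h x * g x).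
Proof.
move=> hi gi; under [X in _ --> X]eq_Rintegral do rewrite mulrC.
have -> : (fun n => \sum_(k < n) c k *
    ((\int[lambda]_x (h x * cosn (nu k) x)) * (\int[lambda]_x (g x * cosn (nu k) x)) +
     (\int[lambda]_x (h x * sinn (nu k) x)) * (\int[lambda]_x (g x * sinn (nu k) x)))) =
    (fun n => \sum_(k < n) \int[lambda]_x (g x *
      (c k * (cos_coef h k * cosn (nu k) x + sin_coef h k * sinn (nu k) x)))).
  apply/funext => n; apply: eq_bigr => k _.
  rewrite [RHS](@eq_Rintegral _ _ _ _ _ (fun x => c k *
      (cos_coef h k * (g x * cosn (nu k) x) + sin_coef h k * (g x * sinn (nu k) x)))).
    have ic : lambda.-integrable setT (EFin \o (fun z => cos_coef h k * (g z * cosn (nu k) z))).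
      by apply: integrableRZ; exact: integrable_mul_cosn.
    have is_ : lambda.-integrable setT (EFin \o (fun z => sin_coef h k * (g z * sinn (nu k) z))).
      by apply: integrableRZ; exact: integrable_mul_sinn.
    rewrite RintegralZl//; last exact: integrableRD.
    by rewrite RintegralD// !RintegralZl//; [exact: integrable_mul_sinn|exact: integrable_mul_cosn].
  by move=> z _; ring.
apply: (@bounded_series_integral _ _ _ lambda g (kconv h) (fun k x =>
  c k * (cos_coef h k * cosn (nu k) x + sin_coef h k * sinn (nu k) x)) (S * (L1 h + L1 h))) => //.
- move=> k; apply: measurable_funM => //.
  by apply: measurable_funD; apply: measurable_funM => //;
    [exact: measurable_cosn|exact: measurable_sinn].
- by move=> n x; exact: conv_partial_le.
- by move=> x; exact: kconv_cvg.
Qed.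

Lemma integrable_kconv_kernel (h : T -> R) x : lambda.-integrable setT (EFin \o h) ->
  lambda.-integrable setT (EFin \o (fun z => h z * F (z - x))).
Proof.
move=> hi; apply: (@integrableRM_bounded _ _ _ _ S) => //.
  have -> : (fun z => F (z - x)) = F \o (fun z => - x + z).
    by apply/funext => z /=; rewrite addrC.
  exact: measurableT_comp measurable_cos_series (measurable_translation _).
by move=> z; exact: cos_series_le.
Qed.

Lemma kconv_translate (h : T -> R) x : measurable_fun setT h ->
  \int[lambda]_y (h (x + y) * F y) = kconv h x.
Proof.
move=> mh; have -> : kconv h x = \int[lambda]_y (h (x + y) * F (x + y - x)).
  apply/esym/(Rintegral_translation haar x (f := fun z => h z * F (z - x))).
  apply: measurable_funM => //.
  have -> : (fun z => F (z - x)) = F \o (fun z => - x + z).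
    by apply/funext => z /=; rewrite addrC.
  exact: measurableT_comp measurable_cos_series (measurable_translation _).
by apply: eq_Rintegral => y _; rewrite addrAC subrr add0r.
Qed.

Lemma kconv_lin (h g : T -> R) a x : lambda.-integrable setT (EFin \o h) ->
  lambda.-integrable setT (EFin \o g) ->
  kconv (fun z => a * h z + g z) x = a * kconv h x + kconv g x.
Proof.
move=> hi gi; rewrite /kconv -RintegralZl//; last exact: integrable_kconv_kernel.
rewrite -RintegralD//; [|apply: integrableRZ|]; try exact: integrable_kconv_kernel.
by apply: eq_Rintegral => z _; ring.
Qed.

Lemma cos_series_sinn m : \int[lambda]_x (sinn m x * F x) = 0.
Proof.
apply: (cvgn_unique (@bounded_series_integral _ _ _ lambda (sinn m) F
  (fun k x => c k * cosn (nu k) x) S _ _ _ _)).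
- exact: integrable_sinn.
- by move=> k; apply: measurable_funM => //; exact: measurable_cosn.
- by move=> n x; exact: cos_partial_le.
- by move=> x; exact: cos_series_cvg.
rewrite (_ : (fun n => _) = cst 0); first exact: cvg_cst.
apply/funext => n; apply: big1 => k _.
under eq_Rintegral do rewrite mulrCA.
rewrite RintegralZl ?Rintegral_sinn_mul ?mulr0//.
by apply: integrable_mul_cosn; exact: integrable_sinn.
Qed.

(** In the integrated series only the terms of index [m] and [- m] survive, each with
weight 1/2. *)
Lemma cos_series_cosn (gamma : 'rV[int]_d -> R) m : bijective nu ->
  (forall k, c k = gamma (nu k)) -> gamma (- m) = gamma m ->
  \int[lambda]_x (cosn m x * F x) = gamma m.
Proof.
move=> [nu' nuK nu'K] cE gammaN.
apply: (cvgn_unique (@bounded_series_integral _ _ _ lambda (cosn m) F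
  (fun k x => c k * cosn (nu k) x) S _ _ _ _)).
- exact: integrable_cosn.
- by move=> k; apply: measurable_funM => //; exact: measurable_cosn.
- by move=> n x; exact: cos_partial_le.
- by move=> x; exact: cos_series_cvg.
have term k : \int[lambda]_x (cosn m x * (c k * cosn (nu k) x)) =
    c k / 2 * (k == nu' (- m))%:R + c k / 2 * (k == nu' m)%:R.
  under eq_Rintegral do rewrite mulrCA.
  rewrite RintegralZl//; last by apply: integrable_mul_cosn; exact: integrable_cosn.
  rewrite Rintegral_cosn_mul -mulrDr.
  have -> : (m + nu k == 0) = (k == nu' (- m)).
    by rewrite addrC addr_eq0 (can2_eq nuK nu'K).
  have -> : (m - nu k == 0) = (k == nu' m).
    by rewrite subr_eq0 eq_sym (can2_eq nuK nu'K).
  by rewrite mulrAC mulrA.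
have pick n (j : nat) : (j < n)%N ->
    \sum_(k < n) c k / 2 * (k == j :> nat)%:R = c j / 2.
  move=> jn; rewrite (bigD1 (Ordinal jn))//= eqxx mulr1 big1 ?addr0// => k kj.
  by rewrite (_ : (k == j :> nat) = false) ?mulr0//; apply: negbTE.
apply: cvg_near_cst; exists (maxn (nu' m) (nu' (- m))).+1 => // n /=.
rewrite gtn_max => /andP[n1 n2]; apply/eqP.
under eq_bigr do rewrite term.
rewrite big_split /= !pick// !cE !nu'K gammaN; lra.
Qed.

End haar.
End cosine_series.

(** * Characters as a Hilbert basis of L^2 of the torus *)

Section L2_torus.
Variables (R : realType) (d : nat) (lambda : probability (torus R d) R).
Local Notation T := (torus R d).
Hypothesis haar : is_haar lambda.
Local Notation dot := (@L2dot _ _ _ lambda).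
Local Notation integrableR f := (lambda.-integrable setT (EFin \o f)).

Lemma bounded_sqintegrable (f : T -> R[i]) (C : R) : cmeasurable f ->
  (forall x, csq (f x) <= C) -> f \in sqintegrable lambda.
Proof.
move=> mf fC; apply: csq_sqintegrable => //.
have : integrableR (fun x => csq (f x)).
  apply: (bounded_integrable lambda (C := C)) (measurable_csq mf) _ => x.
  by rewrite ger0_norm ?csq_ge0.
move=> /integrableP[_]; apply: le_lt_trans.
by under [leRHS]eq_integral do rewrite /= ger0_norm ?csq_ge0//.
Qed.

Lemma sqfun_Re_integrable (f : sqfun lambda) : integrableR (fun x => complex.Re (f x)).
Proof.
have [fr _] := sqfunP f; apply/Lfun1_integrable.
by apply: Lfun_subset12 fr; rewrite fin_num_measure.
Qed.

Lemma sqfun_Im_integrable (f : sqfun lambda) : integrableR (fun x => complex.Im (f x)).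
Proof.
have [_ fi] := sqfunP f; apply/Lfun1_integrable.
by apply: Lfun_subset12 fi; rewrite fin_num_measure.
Qed.

Lemma dot_pi (f g : sqfun lambda) :
  (dot : {dot L2 lambda for @conjc R}) (\pi_(L2 lambda) f) (\pi_(L2 lambda) g) =
  cintegral lambda (fun x => f x * conjc (g x)).
Proof. exact: L2dot_pi. Qed.

Lemma cosn_sqintegrable n : (fun x => (cosn n x)%:C) \in sqintegrable lambda.
Proof.
apply: (@bounded_sqintegrable _ 1) => [|x]; last first.
  by rewrite /csq /= expr0n addr0 -(cos2Dsin2 (phase n x)) lerDl sqr_ge0.
by split; [exact: measurable_cosn|exact: measurable_cst].
Qed.

Lemma sinn_sqintegrable n : (fun x => (sinn n x)%:C) \in sqintegrable lambda.
Proof.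
apply: (@bounded_sqintegrable _ 1) => [|x]; last first.
  by rewrite /csq /= expr0n addr0 -(cos2Dsin2 (phase n x)) lerDr sqr_ge0.
by split; [exact: measurable_sinn|exact: measurable_cst].
Qed.

Lemma chi_sqintegrable n : chi n \in sqintegrable lambda.
Proof.
apply: (@bounded_sqintegrable _ 1) => [|x].
  by split; [exact: measurable_cosn|exact: measurable_sinn].
by rewrite /csq /= cos2Dsin2.
Qed.

Definition cosL2 n : L2 lambda := \pi_(L2 lambda) (SqFun (cosn_sqintegrable n)).
Definition sinL2 n : L2 lambda := \pi_(L2 lambda) (SqFun (sinn_sqintegrable n)).
Definition chiL2 n : L2 lambda := \pi_(L2 lambda) (SqFun (chi_sqintegrable n)).

Lemma dot_cosL2 (f : sqfun lambda) n :
  (dot : {dot L2 lambda for @conjc R}) (\pi_(L2 lambda) f) (cosL2 n) =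
  (\int[lambda]_x (complex.Re (f x) * cosn n x)) +i*
  (\int[lambda]_x (complex.Im (f x) * cosn n x)).
Proof.
rewrite dot_pi /cintegral; congr (_ +i* _); apply: eq_Rintegral => x _ /=.
- by rewrite cReM /= oppr0 mulr0 subr0.
- by rewrite cImM /= oppr0 mulr0 add0r.
Qed.

Lemma dot_sinL2 (f : sqfun lambda) n :
  (dot : {dot L2 lambda for @conjc R}) (\pi_(L2 lambda) f) (sinL2 n) =
  (\int[lambda]_x (complex.Re (f x) * sinn n x)) +i*
  (\int[lambda]_x (complex.Im (f x) * sinn n x)).
Proof.
rewrite dot_pi /cintegral; congr (_ +i* _); apply: eq_Rintegral => x _ /=.
- by rewrite cReM /= oppr0 mulr0 subr0.
- by rewrite cImM /= oppr0 mulr0 add0r.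
Qed.

Lemma sqnorm_cos_sin n : sqnorm dot (cosL2 n) + sqnorm dot (sinL2 n) = 1.
Proof.
rewrite !sqnorm_pi -RintegralD//; [|exact: sqfun_csq_integrable|exact: sqfun_csq_integrable].
rewrite (@eq_Rintegral _ _ _ _ _ (cst 1)); last first.
  by move=> x _; rewrite /csq /= !expr0n !addr0 cos2Dsin2.
by rewrite Rintegral_cst//= [X in fine X](@probability_setT _ _ _ lambda) mulr1.
Qed.

(** Haar measure and the density [1 + h] have the same Fourier coefficients. *)
Lemma zero_coefficients_ae0 (h : T -> R) : integrableR h ->
  (forall n, \int[lambda]_x (h x * cosn n x) = 0) ->
  (forall n, \int[lambda]_x (h x * sinn n x) = 0) ->
  {ae lambda, forall x, h x = 0}.
Proof.
move=> hi hc hs.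
have i1 : integrableR (fun x => 1 + h x).
  by apply: integrableRD => //; exact: finite_measure_integrable_cst.
have key : forall A, measurable A -> lambda A = (\int[lambda]_(x in A) (1 + h x)%:E)%E.
  apply: fourier_coefficients_density => // n.
    under [RHS]eq_Rintegral do rewrite mulrDr mulr1 [_ * h _]mulrC.
    by rewrite RintegralD// ?hc ?addr0//; [exact: integrable_cosn|exact: integrable_mul_cosn].
  under [RHS]eq_Rintegral do rewrite mulrDr mulr1 [_ * h _]mulrC.
  by rewrite RintegralD// ?hs ?addr0//; [exact: integrable_sinn|exact: integrable_mul_sinn].
have : ae_eq lambda setT (EFin \o (fun x => 1 + h x)) (cst 1%E).
  apply: integral_ae_eq => // A _ mA.
  by rewrite -key// integral_cst// mul1e.
by apply: filterS => x /(_ I) /= [] /eqP; rewrite -subr_eq0 addrAC subrr add0r => /eqP.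
Qed.

(** Maximality is the uniqueness of Fourier coefficients.  Orthogonality to [chi n]
mixes the coefficients of the real and imaginary parts of a function; comparing [n]
with [- n] separates them. *)
Lemma chi_hilbert_basis (nu : nat -> 'rV[int]_d) : bijective nu ->
  hilbert_basis dot (fun k => chiL2 (nu k)).
Proof.
move=> [nu' nuK nu'K]; split=> [i j|].
  rewrite dot_pi /cintegral.
  have E (x : T) : chi (nu i) x * conjc (chi (nu j) x) = chi (nu i - nu j) x.
    by rewrite chiDl chiNl.
  rewrite (@eq_Rintegral _ _ _ _ _ (cosn (nu i - nu j))); last first.
    by move=> x _; have [] := E x.
  rewrite [X in _ +i* X](@eq_Rintegral _ _ _ _ _ (sinn (nu i - nu j))); last first.
    by move=> x _; have [] := E x.
  rewrite (Rintegral_cosn haar) (Rintegral_sinn haar) subr_eq0 (can_eq nuK).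
  by case: eqP.
elim/quotW => f f0.
have {}f0 n :
    \int[lambda]_x (complex.Re (f x) * cosn n x) +
      \int[lambda]_x (complex.Im (f x) * sinn n x) = 0 /\
    \int[lambda]_x (complex.Im (f x) * cosn n x) -
      \int[lambda]_x (complex.Re (f x) * sinn n x) = 0.
  have := f0 (nu' n); rewrite nu'K dot_pi => -[E1 E2]; split.
    rewrite -E1 -RintegralD//.
    - by apply: eq_Rintegral => x _; rewrite cReM /= mulrN opprK.
    - by apply: integrable_mul_cosn; exact: sqfun_Re_integrable.
    - by apply: integrable_mul_sinn; exact: sqfun_Im_integrable.
  rewrite -E2 -RintegralB//.
  - by apply: eq_Rintegral => x _; rewrite cImM /= mulrN addrC.
  - by apply: integrable_mul_cosn; exact: sqfun_Im_integrable.
  - by apply: integrable_mul_sinn; exact: sqfun_Re_integrable.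
have even h n : \int[lambda]_x (h x * cosn (- n) x) = \int[lambda]_x (h x * cosn n x).
  by apply: eq_Rintegral => x _; have [E _] := chiNl n x; rewrite /cosn E.
have odd h n : integrableR h ->
    \int[lambda]_x (h x * sinn (- n) x) = - \int[lambda]_x (h x * sinn n x).
  move=> hi; rewrite -mulN1r -RintegralZl//; last exact: integrable_mul_sinn.
  by apply: eq_Rintegral => x _; have [_ E] := chiNl n x; rewrite /sinn E mulN1r mulrN.
have ri := sqfun_Re_integrable f; have ii := sqfun_Im_integrable f.
have coef n : [/\ \int[lambda]_x (complex.Re (f x) * cosn n x) = 0,
    \int[lambda]_x (complex.Re (f x) * sinn n x) = 0,
    \int[lambda]_x (complex.Im (f x) * cosn n x) = 0 &
    \int[lambda]_x (complex.Im (f x) * sinn n x) = 0].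
  have [e1 e2] := f0 n; have [e3 e4] := f0 (- n).
  move: e3 e4; rewrite !even !odd// => e3 e4; split; lra.
have r0 : {ae lambda, forall x, complex.Re (f x) = 0}.
  by apply: zero_coefficients_ae0 => // n; have [] := coef n.
have i0 : {ae lambda, forall x, complex.Im (f x) = 0}.
  by apply: zero_coefficients_ae0 => // n; have [] := coef n.
have -> : (0 : L2 lambda) = \pi_(L2 lambda) 0 by rewrite raddf0.
apply/L2P; apply: filterS2 r0 i0 => x xr xi.
exact: complex_ext.
Qed.

End L2_torus.

(** * The convolution operator on L^2 *)

Section convolution_operator.
Variables (R : realType) (d : nat) (lambda : probability (torus R d) R).
Local Notation T := (torus R d).
Hypothesis haar : is_haar lambda.
Local Notation dot := (@L2dot _ _ _ lambda).
Variables (c : nat -> R) (S : R) (nu : nat -> 'rV[int]_d).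
Hypothesis c_ge0 : forall k, 0 <= c k.
Hypothesis c_sum : (fun n => \sum_(k < n) c k) @ \oo --> S.
Local Notation F := (cos_series c nu).
Local Notation convF := (kconv c nu lambda).

Definition conv_fun (f : T -> R[i]) (x : T) : R[i] :=
  convF (fun z => complex.Re (f z)) x +i* convF (fun z => complex.Im (f z)) x.

Lemma conv_sqintegrable (f : sqfun lambda) : conv_fun f \in sqintegrable lambda.
Proof.
have ri := sqfun_Re_integrable f; have ii := sqfun_Im_integrable f.
have [C1 C1P] := kconv_bounded nu c_ge0 c_sum ri.
have [C2 C2P] := kconv_bounded nu c_ge0 c_sum ii.
apply: (@bounded_sqintegrable _ _ _ _ (C1 ^+ 2 + C2 ^+ 2)) => [|x].
  split; [exact: (measurable_kconv nu c_ge0 c_sum ri)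
         |exact: (measurable_kconv nu c_ge0 c_sum ii)].
have sq (a b : R) : `|a| <= b -> a ^+ 2 <= b ^+ 2.
  by move=> ab; rewrite -[a ^+ 2]real_normK ?num_real// lerXn2r ?nnegrE// (le_trans _ ab).
by apply: lerD; apply: sq; [exact: C1P|exact: C2P].
Qed.

Definition conv_sqfun (f : sqfun lambda) : sqfun lambda := SqFun (conv_sqintegrable f).

Definition conv_op (u : L2 lambda) : L2 lambda := \pi_(L2 lambda) (conv_sqfun (repr u)).

Lemma conv_op_pi (f : sqfun lambda) :
  conv_op (\pi_(L2 lambda) f) = \pi_(L2 lambda) (conv_sqfun f).
Proof.
apply/L2P; apply: aeW => x /=; set g := repr _.
have /L2P gf : g = f %[mod L2 lambda] by rewrite reprK.
have E (p : R[i] -> R) : lambda.-integrable setT (EFin \o (fun z => p (f z))) ->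
    lambda.-integrable setT (EFin \o (fun z => p (g z))) ->
    convF (fun z => p (g z)) x = convF (fun z => p (f z)) x.
  move=> fi gi; congr fine; apply: ae_eq_integral => //.
  - exact: measurable_int (integrable_kconv_kernel nu c_ge0 c_sum x gi).
  - exact: measurable_int (integrable_kconv_kernel nu c_ge0 c_sum x fi).
  - by apply: filterS gf => z -> _.
by rewrite /conv_fun !(E (@complex.Re R), E (@complex.Im R));
  [|exact: sqfun_Im_integrable..|exact: sqfun_Re_integrable|exact: sqfun_Re_integrable].
Qed.

Lemma conv_op_linear : linear conv_op.
Proof.
move=> a; elim/quotW => f; elim/quotW => g.
rewrite [a *: _]pi_L2scale -raddfD !conv_op_pi.
rewrite [a *: _]pi_L2scale -raddfD; congr (\pi_(L2 lambda) _).
apply/val_inj/funext => x /=; rewrite /conv_fun !fctE.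
have fr := sqfun_Re_integrable f; have fi := sqfun_Im_integrable f.
have gr := sqfun_Re_integrable g; have gi := sqfun_Im_integrable g.
have lin := kconv_lin nu c_ge0 c_sum.
case: a => a1 a2; apply: complex_ext => /=.
- rewrite (_ : (fun z => _) = fun z =>
      a1 * complex.Re (f z) + (- a2 * complex.Im (f z) + complex.Re (g z))).
    by rewrite !lin//; [ring|apply: integrableRD => //; exact: integrableRZ].
  by apply/funext => z; case: (f z) (g z) => [? ?] [? ?] /=; ring.
- rewrite (_ : (fun z => _) = fun z =>
      a1 * complex.Im (f z) + (a2 * complex.Re (f z) + complex.Im (g z))).
    by rewrite !lin//; [ring|apply: integrableRD => //; exact: integrableRZ].
  by apply/funext => z; case: (f z) (g z) => [? ?] [? ?] /=; ring.
Qed.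

HB.instance Definition _ := GRing.isLinear.Build R[i] (L2 lambda) (L2 lambda) *:%R
  conv_op conv_op_linear.

Lemma conv_op_is_conv : is_conv_op F conv_op.
Proof.
move=> f; rewrite conv_op_pi.
have /L2P : repr (\pi_(L2 lambda) (conv_sqfun f)) = conv_sqfun f %[mod L2 lambda].
  by rewrite reprK.
apply: filterS => x; rewrite /L2fun => ->.
have [mr mi] := sqfun_measurable f.
rewrite /= /conv_fun /cintegral.
rewrite -(kconv_translate nu c_ge0 c_sum haar x mr).
rewrite -(kconv_translate nu c_ge0 c_sum haar x mi).
by congr (_ +i* _); apply: eq_Rintegral => y _; rewrite ?cReM ?cImM /= ?mulr0 ?subr0 ?add0r.
Qed.

Let cc (h : T -> R) k := \int[lambda]_x (h x * cosn (nu k) x).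
Let ss (h : T -> R) k := \int[lambda]_x (h x * sinn (nu k) x).

Let pairing (h g : T -> R) : lambda.-integrable setT (EFin \o h) ->
  lambda.-integrable setT (EFin \o g) ->
  (fun n => \sum_(k < n) c k * (cc h k * cc g k + ss h k * ss g k)) @ \oo -->
    \int[lambda]_x (convF h x * g x).
Proof. by move=> hi gi; exact: (@kconv_pairing R d c S nu c_ge0 c_sum lambda h g hi gi). Qed.

Let integrable_conv_mul (h g : T -> R) : lambda.-integrable setT (EFin \o h) ->
  lambda.-integrable setT (EFin \o g) ->
  lambda.-integrable setT (EFin \o (fun x => convF h x * g x)).
Proof.
move=> hi gi; have [C hC] := kconv_bounded nu c_ge0 c_sum hi.
under eq_fun do rewrite mulrC.
exact: integrableRM_bounded gi (measurable_kconv nu c_ge0 c_sum hi) hC.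
Qed.

Let b k (u v : L2 lambda) : R[i] :=
  L2dot u (cosL2 lambda (nu k)) * conjc (L2dot v (cosL2 lambda (nu k))) +
  L2dot u (sinL2 lambda (nu k)) * conjc (L2dot v (sinL2 lambda (nu k))).

Let bE k (f g : sqfun lambda) :
  b k (\pi_(L2 lambda) f) (\pi_(L2 lambda) g) =
  let fr z := complex.Re (f z) in let fi z := complex.Im (f z) in
  let gr z := complex.Re (g z) in let gi z := complex.Im (g z) in
  (cc fr k * cc gr k + ss fr k * ss gr k + (cc fi k * cc gi k + ss fi k * ss gi k)) +i*
  (cc fi k * cc gr k + ss fi k * ss gr k - (cc fr k * cc gi k + ss fr k * ss gi k)).
Proof.
by rewrite /b !dot_cosL2 !dot_sinL2; apply: complex_ext => /=; rewrite /cc /ss; ring.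
Qed.

Lemma conv_op_Re u v :
  (fun n => \sum_(k < n) c k * complex.Re (b k u v)) @ \oo -->
  complex.Re (L2dot (conv_op u) v).
Proof.
elim/quotW: u => f; elim/quotW: v => g.
have fr := sqfun_Re_integrable f; have fi := sqfun_Im_integrable f.
have gr := sqfun_Re_integrable g; have gi := sqfun_Im_integrable g.
pose fR z := complex.Re (f z); pose fI z := complex.Im (f z).
pose gR z := complex.Re (g z); pose gI z := complex.Im (g z).
set L := (X in X @ _); rewrite conv_op_pi [L2dot _ _]dot_pi /=.
under [X in _ --> X]eq_Rintegral do rewrite cReM cReJ cImJ mulrN opprK.
rewrite RintegralD//; [|exact: integrable_conv_mul|exact: integrable_conv_mul].
rewrite (_ : L = fun n =>
    \sum_(k < n) c k * (cc fR k * cc gR k + ss fR k * ss gR k) +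
    \sum_(k < n) c k * (cc fI k * cc gI k + ss fI k * ss gI k)).
  by apply: cvgD; exact: pairing.
by apply/funext => n; rewrite /L -big_split; apply: eq_bigr => k _; rewrite bE /= mulrDr.
Qed.

Lemma conv_op_Im u v :
  (fun n => \sum_(k < n) c k * complex.Im (b k u v)) @ \oo -->
  complex.Im (L2dot (conv_op u) v).
Proof.
elim/quotW: u => f; elim/quotW: v => g.
have fr := sqfun_Re_integrable f; have fi := sqfun_Im_integrable f.
have gr := sqfun_Re_integrable g; have gi := sqfun_Im_integrable g.
pose fR z := complex.Re (f z); pose fI z := complex.Im (f z).
pose gR z := complex.Re (g z); pose gI z := complex.Im (g z).
set L := (X in X @ _); rewrite conv_op_pi [L2dot _ _]dot_pi /=.
under [X in _ --> X]eq_Rintegral do rewrite cImM cReJ cImJ mulrN addrC.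
rewrite RintegralB//; [|exact: integrable_conv_mul|exact: integrable_conv_mul].
rewrite (_ : L = fun n =>
    \sum_(k < n) c k * (cc fI k * cc gR k + ss fI k * ss gR k) -
    \sum_(k < n) c k * (cc fR k * cc gI k + ss fR k * ss gI k)).
  by apply: cvgB; exact: pairing.
by apply/funext => n; rewrite /L -sumrB; apply: eq_bigr => k _; rewrite bE /= mulrBr.
Qed.

(** The operator is diagonalised by the functions [cosn] and [sinn], with total weight
[S], and [S] is the value of the kernel at the origin. *)
Theorem conv_op_trace (nu_bij : bijective nu) :
  [/\ is_conv_op F conv_op, trace_class dot conv_op & is_trace dot conv_op (F 0)%:C].
Proof.
have unit k := sqnorm_cos_sin lambda (nu k).
split.
- exact: conv_op_is_conv.
- apply: (diag_trace_class c_ge0 c_sum unit conv_op_Re conv_op_Im).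
    exact: riesz_fischer.
  by exists (fun k => chiL2 lambda (nu k)); exact: chi_hilbert_basis.
- rewrite (cos_series0 nu c_sum).
  by apply: (diag_trace c_ge0 c_sum unit conv_op_Re conv_op_Im); exact: riesz_fischer.
Qed.

End convolution_operator.

(** * The image of the stable law on the torus *)

Section image_on_torus.
Variables (R : realType) (d : nat) (mu : probability (borelRd R d) R).
Local Notation T := (torus R d).

Definition coset_mfun : {mfun borelRd R d >-> T} :=
  HB.pack (@coset R d) (isMeasurableFun.Build _ _ _ _ _ (@measurable_coset R d)).

(** Change of variables along the quotient map; the minus sign is the one in the
exponent of the Fourier transform. *)
Lemma fourier_distribution n (z : R) : fourier mu (- intvec R n) = z%:C ->
  \int[distribution mu coset_mfun]_x cosn n x = z /\
  \int[distribution mu coset_mfun]_x sinn n x = 0.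
Proof.
rewrite /fourier /cintegral => -[E1 E2].
have tr (f : T -> R) (C : R) : measurable_fun setT f -> (forall x, `|f x| <= C) ->
    \int[distribution mu coset_mfun]_x f x = \int[mu]_x f (coset x).
  move=> mf fC; rewrite /Rintegral integral_pushforward//.
  - exact/measurable_EFinP.
  - rewrite ?preimage_setT; apply: (bounded_integrable mu (C := C)) => //.
    exact: measurableT_comp mf (@measurable_coset R d).
have ph x : - (2 * pi * dotp x (- intvec R n)) = 2 * pi * dotp (intvec R n) x :> R.
  by rewrite [dotp x _]dotpC dotpNl mulrN opprK.
split.
- rewrite (tr _ 1); [|exact: measurable_cosn|by move=> x; exact: cos_max].
  rewrite -E1; apply: eq_Rintegral => x _.
  by rewrite /coset cosn_pi /= ph.
- rewrite (tr _ 1); [|exact: measurable_sinn|by move=> x; exact: sin_max].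
  rewrite -E2; apply: eq_Rintegral => x _.
  by rewrite /coset sinn_pi /= ph.
Qed.

End image_on_torus.

Theorem mainTheorem2 (R : realType) (d : nat) (alpha sigma : R)
    (lambda : probability (torus R d) R)
    (mu : R -> probability (borelRd R d) R) :
  (0 < d)%N -> 0 < alpha -> alpha < 2 -> 0 < sigma ->
  is_haar lambda ->
  (forall (t : R) (y : 'rV[R]_d), 0 <= t ->
     fourier (mu t) y = (expR (- (t * sigma * enorm y `^ alpha)))%:C) ->
  forall t : R, 0 < t ->
  exists F : torus R d -> R,
    [/\ continuous F,
        (forall A : set (torus R d), measurable A ->
           pushforward (mu t) (@coset R d) A =
             (\int[lambda]_(x in A) (F x)%:E)%E)
      & exists P : {linear L2 lambda -> L2 lambda},
          [/\ is_conv_op F P,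
              trace_class (@L2dot _ _ _ lambda) P
            & is_trace (@L2dot _ _ _ lambda) P (F 0)%:C]].
Proof.
move=> d0 alpha0 _ sigma0 haar muE t t0.
have [nu nu_bij] := lattice_enum d0.
pose gamma (n : 'rV[int]_d) := expR (- (t * sigma * enorm (intvec R n) `^ alpha)).
pose c k := gamma (nu k).
have c_ge0 k : 0 <= c k by exact: expR_ge0.
have /cvg_ex[S c_sum] : cvgn (fun n => \sum_(k < n) c k).
  by apply: lattice_expR_summable => //; [exact: mulr_gt0|exact: bij_inj].
have enormN y : enorm (- y) = enorm y :> R.
  by rewrite /enorm dotpNl dotpC dotpNl opprK.
have gammaN n : gamma (- n) = gamma n by rewrite /gamma intvecN enormN.
have coef n : fourier (mu t) (- intvec R n) = (gamma n)%:C.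
  by rewrite (muE _ _ (ltW t0)) enormN.
exists (cos_series c nu); split.
- exact: continuous_cos_series c_ge0 c_sum.
- apply: (@fourier_coefficients_density _ _ (distribution (mu t) (coset_mfun R d)) lambda).
  + apply: (bounded_integrable lambda (C := S)).
      exact: measurable_cos_series c_ge0 c_sum.
    by move=> x; exact: cos_series_le.
  + move=> n; have [-> _] := fourier_distribution (coef n).
    by rewrite (cos_series_cosn c_ge0 c_sum haar nu_bij (gamma := gamma)).
  + move=> n; have [_ ->] := fourier_distribution (coef n).
    by rewrite (cos_series_sinn nu c_ge0 c_sum haar).
- exists (conv_op nu c_ge0 c_sum : {linear L2 lambda -> L2 lambda}).
  exact: conv_op_trace.
Qed.
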